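(* $$\frac{1}{1-t}+\frac{1}{2(1-t)^2}\sum_{n=1}^\infty\frac{(1+t^2)^n}{(1-t^2)^{n-1}}I_n^{(\mathrm{udr},\mathrm{fix})}\left(\frac{2t}{1+t^2},z\right)x^n=\sum_{k=0}^\infty\frac{(1+zx)^k(1+x^2)^{k^2}t^{2k}}{(1-zx)^k(1-x^2)^{k^2}}\left(1+\frac{(1+x^2)^kt}{(1-zx)(1-x^2)^k}\right).$$
   Context: For a permutation $\pi=\pi(1)\cdots\pi(n)$ of $[n]=\{1,\dots,n\}$, a birun is a maximal monotone consecutive subsequence of $\pi$, and an up-down run is a birun of $\pi$, or the single letter $\pi(1)$ if $\pi(1)>\pi(2)$; $\mathrm{udr}(\pi)$ is the number of up-down runs (equal to $1$ for the permutation of length $1$; e.g. $71462853$ has up-down runs $7,71,146,62,28,853$). $\mathrm{fix}(\pi)$ is the number of fixed points. $\mathfrak{I}_n$ is the set of involutions of $[n]$ (permutations $\pi$ with $\pi^2$ the identity), and $$I_n^{(\mathrm{udr},\mathrm{fix})}(t,z)=\sum_{\pi\in\mathfrak{I}_n}t^{\mathrm{udr}(\pi)}z^{\mathrm{fix}(\pi)}.$$ The identity is between formal power series in $x$ and $t$; rational functions of $t$ are expanded as power series in $t$. *)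

(* Defs.v *)
From HB Require Import structures.
From mathcomp Require Import all_boot all_order all_algebra all_fingroup.
From mathcomp Require Import boolp.

Set Implicit Arguments.
Unset Strict Implicit.
Unset Printing Implicit Defensive.

Import GRing.Theory.
Local Open Scope ring_scope.

(** * Formal power series in one variable

    [{fps R}] is R[[X]], with the Cauchy product; bivariate series are obtained
    by iteration.  A series is a unit iff its constant coefficient is one, so
    that [/] is genuine division for such denominators. *)

Record fps (R : Type) := Fps { fps_coef : nat -> R }.

Declare Scope fps_scope.
Local Open Scope fps_scope.
Notation "{ 'fps' R }" := (fps R) (at level 0, format "{ 'fps'  R }")
  : type_scope.
Notation "f .[# n ]" := (fps_coef f n)
  (at level 1, left associativity, format "f .[# n ]") : fps_scope.

HB.instance Definition _ (R : Type) := gen_eqMixin {fps R}.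
HB.instance Definition _ (R : Type) := gen_choiceMixin {fps R}.

Lemma fpsP (R : Type) (f g : {fps R}) : (forall n, f.[# n] = g.[# n]) <-> f = g.
Proof.
split=> [|-> //]; case: f g => [f] [g] /= fg.
by congr Fps; apply/funext.
Qed.

Section Zmodule.
Variable R : zmodType.
Implicit Types f g : {fps R}.

Definition fps_zero : {fps R} := Fps (fun=> 0).
Definition fps_add f g : {fps R} := Fps (fun n => f.[# n] + g.[# n]).
Definition fps_opp f : {fps R} := Fps (fun n => - f.[# n]).

Fact fps_addA : associative fps_add.
Proof. by move=> f g h; apply/fpsP => n; exact: addrA. Qed.
Fact fps_addC : commutative fps_add.
Proof. by move=> f g; apply/fpsP => n; exact: addrC. Qed.
Fact fps_add0 : left_id fps_zero fps_add.
Proof. by move=> f; apply/fpsP => n; exact: add0r. Qed.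
Fact fps_addN : left_inverse fps_zero fps_opp fps_add.
Proof. by move=> f; apply/fpsP => n; exact: addNr. Qed.

HB.instance Definition _ := GRing.isZmodule.Build {fps R}
  fps_addA fps_addC fps_add0 fps_addN.

Lemma fps_coef0 n : (0 : {fps R}).[# n] = 0. Proof. by []. Qed.
Lemma fps_coefD f g n : (f + g).[# n] = f.[# n] + g.[# n]. Proof. by []. Qed.
Lemma fps_coefN f n : (- f).[# n] = - f.[# n]. Proof. by []. Qed.
Lemma fps_coefB f g n : (f - g).[# n] = f.[# n] - g.[# n]. Proof. by []. Qed.
Lemma fps_coef_sum (I : Type) (r : seq I) (P : pred I) (F : I -> {fps R}) n :
  (\sum_(i <- r | P i) F i).[# n] = \sum_(i <- r | P i) (F i).[# n].
Proof. exact: (big_morph (fun f : {fps R} => f.[# n])). Qed.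

End Zmodule.

Section Ring.
Variable R : comNzRingType.
Implicit Types f g h : {fps R}.

Definition fpsC (c : R) : {fps R} := Fps (fun n => if n == 0%N then c else 0).
Definition fpsX : {fps R} := Fps (fun n => (n == 1%N)%:R).
Definition fps_mul f g : {fps R} :=
  Fps (fun n => \sum_(i < n.+1) f.[# i] * g.[# n - i]).

Fact fps_mulC : commutative fps_mul.
Proof.
move=> f g; apply/fpsP => n /=; rewrite (reindex_inj rev_ord_inj) /=.
by apply: eq_bigr => i _; rewrite subSS subKn -1?ltnS // mulrC.
Qed.

Fact fps_mulA : associative fps_mul.
Proof.
move=> f g h; rewrite [RHS]fps_mulC (fps_mulC g h); apply/fpsP => n /=.
pose F i j := f.[# i] * (h.[# j] * g.[# n - i - j]).
transitivity (\sum_(i < n.+1) \sum_(j < n.+1 | (j <= n - i)%N) F i j).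
  apply: eq_bigr => /= i _; rewrite big_distrr /=.
  by rewrite (big_ord_narrow_leq (leq_subr _ _)).
rewrite (exchange_big_dep predT) //=; apply: eq_bigr => j _.
transitivity (\sum_(i < n.+1 | (i <= n - j)%N) F i j).
  apply: eq_bigl => i; rewrite -ltnS -(ltnS i) -!subSn ?leq_ord //.
  by rewrite -subn_gt0 -(subn_gt0 i) -!subnDA addnC.
rewrite (big_ord_narrow_leq (leq_subr _ _)) big_distrr /=.
by apply: eq_bigr => i _; rewrite /F mulrCA -!subnDA addnC.
Qed.

Fact fps_mul1 : left_id (fpsC 1) fps_mul.
Proof.
move=> f; apply/fpsP => n /=; rewrite big_ord_recl /= mul1r subn0 big1 ?addr0 //.
by move=> i _; rewrite mul0r.
Qed.

Fact fps_mulDl : left_distributive fps_mul (@fps_add R).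
Proof.
move=> f g h; apply/fpsP => n /=; rewrite -big_split /=.
by apply: eq_bigr => i _; rewrite mulrDl.
Qed.

Fact fps_1_neq0 : fpsC 1 != 0 :> {fps R}.
Proof. by apply/eqP => /fpsP/(_ 0%N)/eqP; rewrite /= oner_eq0. Qed.

HB.instance Definition _ := GRing.Zmodule_isComNzRing.Build {fps R}
  fps_mulA fps_mulC fps_mul1 fps_mulDl fps_1_neq0.

Lemma fps_coef1 n : (1 : {fps R}).[# n] = (n == 0%N)%:R.
Proof. by case: n. Qed.
Lemma fps_coefM f g n : (f * g).[# n] = \sum_(i < n.+1) f.[# i] * g.[# n - i].
Proof. by []. Qed.
Lemma fps_coefC c n : (fpsC c).[# n] = if n == 0%N then c else 0.
Proof. by []. Qed.
Lemma fps_coefX n : fpsX.[# n] = (n == 1%N)%:R. Proof. by []. Qed.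
Lemma fps_coefM0 f g : (f * g).[# 0] = f.[# 0] * g.[# 0].
Proof. by rewrite fps_coefM big_ord1. Qed.

Fact fpsC_is_zmod_morphism : zmod_morphism fpsC.
Proof. by move=> a b; apply/fpsP => -[|n] //=; rewrite subr0. Qed.
Fact fpsC_is_monoid_morphism : monoid_morphism fpsC.
Proof.
split=> // a b; apply/fpsP => n; rewrite fps_coefM big_ord_recl big1 ?addr0.
  by rewrite subn0 /=; case: n => //= n; rewrite mulr0.
by move=> i _; rewrite mul0r.
Qed.
HB.instance Definition _ :=
  GRing.isZmodMorphism.Build R {fps R} fpsC fpsC_is_zmod_morphism.
HB.instance Definition _ :=
  GRing.isMonoidMorphism.Build R {fps R} fpsC fpsC_is_monoid_morphism.

Lemma fps_coefX_lt f k n : f.[# 0] = 0 -> (n < k)%N -> (f ^+ k).[# n] = 0.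
Proof.
move=> f0; elim: k n => // k IHk n; rewrite ltnS => le_nk.
rewrite exprS fps_coefM big_ord_recl f0 mul0r add0r big1 // => i _.
rewrite IHk ?mulr0 // (leq_trans _ le_nk) // /= /bump /= add1n subnS.
by rewrite prednK ?leq_subr // subn_gt0.
Qed.

End Ring.

Section UnitRing.
Variable R : comUnitRingType.
Implicit Types f g h : {fps R}.

Definition fps_unit : pred {fps R} := [pred f : {fps R} | f.[# 0] \is a GRing.unit].

(* f = c (1 - h) with c the constant coefficient and h_0 = 0; the inverse is
   c^-1 (1 + h + h^2 + ...), and h^k does not contribute in degree < k. *)
Definition fps_inv f : {fps R} :=
  if f \in fps_unit then
    let h := 1 - fpsC (f.[# 0])^-1 * f in
    fpsC (f.[# 0])^-1 * Fps (fun n => (\sum_(k < n.+1) h ^+ k).[# n])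
  else f.

Fact fps_mulVf : {in fps_unit, left_inverse 1 fps_inv *%R}.
Proof.
move=> f Uf; rewrite /fps_inv Uf /=; rewrite inE in Uf.
set c := fpsC _; set h := 1 - c * f; set G := Fps _.
have h0 : h.[# 0] = 0.
  by rewrite /h fps_coefB fps_coefM0 fps_coefC mulVr //= subrr.
rewrite mulrAC (_ : c * f = 1 - h); last by rewrite /h subKr.
apply/fpsP => n; pose S := \sum_(k < n.+1) h ^+ k.
have GS m : (m <= n)%N -> G.[# m] = S.[# m].
  move=> le_mn; rewrite /= !fps_coef_sum.
  rewrite (big_ord_widen n.+1 (fun k => (h ^+ k).[# m])) //.
  rewrite big_mkcond /=; apply: eq_bigr => k _; case: ltnP => // lt_mk.
  by rewrite fps_coefX_lt.
have -> : ((1 - h) * G).[# n] = ((1 - h) * S).[# n].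
  by apply: eq_bigr => i _; rewrite GS // leq_subr.
rewrite -opprB mulNr -subrX1 opprB fps_coefB fps_coefX_lt ?subr0 //.
Qed.

Fact fps_unitPl f g : g * f = 1 -> f \in fps_unit.
Proof.
move=> /fpsP/(_ 0%N); rewrite fps_coefM0 => gf1; rewrite inE.
by apply/unitrPr; exists g.[# 0]; rewrite mulrC gf1.
Qed.

Fact fps_inv_out : {in [predC fps_unit], fps_inv =1 id}.
Proof. by move=> f; rewrite inE /fps_inv => /negbTE ->. Qed.

HB.instance Definition _ := GRing.ComNzRing_hasMulInverse.Build {fps R}
  fps_mulVf fps_unitPl fps_inv_out.

Lemma fps_unitE f : (f \is a GRing.unit) = (f.[# 0] \is a GRing.unit).
Proof. by []. Qed.

End UnitRing.

(** * The ring Q[z][[t]][[x]] = Q[z][[x, t]]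

    For [f : QzTX], [f.[# n].[# j]] is the coefficient of x^n t^j, a polynomial
    in z. *)

Notation QzTX := {fps {fps {poly rat}}}.

Definition varx : QzTX := fpsX {fps {poly rat}}.
Definition vart : QzTX := fpsC (fpsX {poly rat}).
Definition varz : QzTX := fpsC (fpsC 'X).

(* [series_sum m F S] : the series F_m + F_(m+1) + ... converges to S, i.e. each
   coefficient of its partial sums is eventually constant, equal to that of S. *)
Definition series_sum (m : nat) (F : nat -> QzTX) (S : QzTX) : Prop :=
  forall n j : nat, exists N : nat, forall M : nat, (N <= M)%N ->
    (\sum_(m <= k < M) F k).[# n].[# j] = S.[# n].[# j].

Lemma series_sum_unique m F S S' :
  series_sum m F S -> series_sum m F S' -> S = S'.
Proof.
move=> FS FS'; apply/fpsP => n; apply/fpsP => j.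
have [N HN] := FS n j; have [N' HN'] := FS' n j.
by rewrite -(HN (maxn N N')) ?leq_maxl // HN' ?leq_maxr.
Qed.

(** * Up-down runs

    Permutations of [n] are [{perm 'I_n}] (letters and positions shifted by one).
    A nonempty consecutive subsequence pi(a) ... pi(b) is encoded by the pair
    (a, b) of its end positions, a <= b. *)

Section UpDownRuns.
Variables (n : nat) (pi : {perm 'I_n}).

Definition increasing_on (a b : 'I_n) : bool :=
  [forall i : 'I_n, forall j : 'I_n,
     [&& a <= i, i < j & j <= b]%N ==> (pi i < pi j)%N].

Definition decreasing_on (a b : 'I_n) : bool :=
  [forall i : 'I_n, forall j : 'I_n,
     [&& a <= i, i < j & j <= b]%N ==> (pi j < pi i)%N].

Definition monotone_segment (a b : 'I_n) : bool :=
  (a <= b)%N && (increasing_on a b || decreasing_on a b).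

Definition birun (a b : 'I_n) : bool :=
  monotone_segment a b &&
  [forall c : 'I_n, forall d : 'I_n,
     [&& c <= a, b <= d & monotone_segment c d]%N ==> (c == a) && (d == b)].

Definition initial_descent_letter (a b : 'I_n) : bool :=
  [&& a == 0 :> nat, b == 0 :> nat &
      [exists j : 'I_n, (j == 1 :> nat) && (pi j < pi a)%N]].

Definition updown_run (a b : 'I_n) : bool :=
  birun a b || initial_descent_letter a b.

Definition udr : nat := #|[set ab : 'I_n * 'I_n | updown_run ab.1 ab.2]|.

Definition fix_count : nat := #|[set i : 'I_n | pi i == i]|.

End UpDownRuns.

Definition involutions (n : nat) : {set {perm 'I_n}} :=
  [set pi : {perm 'I_n} | (pi * pi == 1)%g].

Definition I_udr_fix (A : comNzRingType) (n : nat) (t z : A) : A :=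
  \sum_(pi in involutions n) t ^+ udr pi * z ^+ fix_count pi.

(* Main.v *)
From HB Require Import structures.
From mathcomp Require Import all_boot all_order all_algebra all_fingroup.
Require Import Defs.
From mathcomp Require Import zify ring.

Set Implicit Arguments.
Unset Strict Implicit.
Unset Printing Implicit Defensive.

Import GRing.Theory.
Local Open Scope ring_scope.
Local Open Scope fps_scope.

(** Both sides count pairs (pi, f), where pi is an involution of [n] and f is a
    weakly increasing labeling of the positions by letters 0, ..., m-1 such that
    pi increases along each block of positions with a given even label and
    decreases along each block with a given odd label; x marks n, t marks m and
    z marks the fixed points of pi.

    Left side.  Fix pi.  Reading a labeling from left to right, the choices at
    an ascent, sorted by the parities of the old and of the new label, are
    counted by the rank-one matrix (1,t)^T (1,t) / (1-t^2), and at a descent by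
    (t,1)^T (t,1) / (1-t^2).  The product along pi telescopes into scalar
    products, 1+t^2 when two consecutive steps agree and 2t when they differ.
    The number of disagreements, with a fictitious ascent before the first step,
    is udr(pi) - 1, so the series of pi is the summand of the left side
    ([involution_seriesS]; its ingredients are [transfer_seriesE] and [udrE]).

    Right side.  Fix m.  Send (pi, f) to the symmetric matrix
    A(i,j) = #{p : f(p) = i, f(pi(p)) = j}.  The word of pairs (f(p), f(pi(p)))
    is sorted for a lexicographic order twisted by the parity of the first
    letter, hence A determines it; and pi is recovered from the word f o pi by
    standardization: pi(q) < pi(p) iff f(pi(q)) < f(pi(p)), or these labels agree
    and q < p (even label) or p < q (odd label).  So the pairs correspond
    bijectively to the symmetric matrices whose entries are at most 1 at places
    (i,j) of mixed parity ([class_count_inj], [labeled_involution_exists]): this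
    is the super-analogue of the bijection between involutions and symmetric
    matrices that underlies the product of all 1/(1-z x_i) and, for i<j, all
    1/(1-x_i x_j).  An even diagonal entry a accounts for a fixed points, an odd
    one for a mod 2.  Hence the series for m letters is a product over i <= j of
    geometric-type series ([chain_series_coef]), which evaluates to the summands
    of t^(2k) and t^(2k+1) on the right ([chain_series_even],
    [chain_series_odd]). *)

(** * Sorted words and standardization *)

Lemma count_word n (T : eqType) (w : 'I_n -> T) c :
  count_mem c [seq w p | p <- enum 'I_n] = #|[set p | w p == c]|.
Proof.
rewrite count_map -sum1_count big_enum_cond -sum1_card /=.
by apply: eq_bigl => p; rewrite inE.
Qed.

(** A word that is sorted for an antisymmetric order is the sorted listing of its
    multiset of letters. *)
Lemma sorted_word_uniq n (T : eqType) (r : rel T) (w w' : 'I_n -> T) :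
    transitive r -> antisymmetric r ->
    (forall p q : 'I_n, (p < q)%N -> r (w p) (w q)) ->
    (forall p q : 'I_n, (p < q)%N -> r (w' p) (w' q)) ->
    (forall c, #|[set p | w p == c]| = #|[set p | w' p == c]|) ->
  w =1 w'.
Proof.
move=> r_tr r_asym w_mon w'_mon eq_ww'.
have sortedP (v : 'I_n -> T) : (forall p q : 'I_n, (p < q)%N -> r (v p) (v q)) ->
    sorted r [seq v p | p <- enum 'I_n].
  move=> v_mon; rewrite sorted_map.
  apply: (@sub_sorted _ (relpre val ltn)); first by move=> p q; exact: v_mon.
  by rewrite -sorted_map val_enum_ord iota_ltn_sorted.
have: [seq w p | p <- enum 'I_n] = [seq w' p | p <- enum 'I_n].
  apply: (sorted_eq r_tr r_asym); [exact: sortedP | exact: sortedP |].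
  by apply/allP => c _; apply/eqP; rewrite !count_word.
by move/eq_in_map => eq_w p; apply: eq_w; rewrite mem_enum.
Qed.

Lemma sorted_word_exists n (C : finType) (r : rel C) (A : C -> nat) :
    transitive r -> total r -> (\sum_c A c = n)%N ->
  exists w : 'I_n -> C, (forall p q : 'I_n, (p < q)%N -> r (w p) (w q)) /\
    (forall c, #|[set p | w p == c]| = A c).
Proof.
move=> r_tr r_tot sumA.
pose s := sort r (flatten [seq nseq (A c) c | c <- enum C]).
have count_s c : count_mem c s = A c.
  rewrite count_sort count_flatten -map_comp sumnE big_map big_enum /=.
  rewrite (bigD1 c) //= count_nseq /= eqxx mul1n big1 ?addn0 // => d /negbTE dc.
  by rewrite count_nseq /= dc.
have size_s : size s = n.
  rewrite size_sort size_flatten /shape -map_comp sumnE big_map big_enum /=.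
  by rewrite -sumA; apply: eq_bigr => c _; rewrite size_nseq.
case: n => [|n] in size_s sumA *.
  have A0 c : A c = 0%N by apply/eqP; move/eqP: sumA; rewrite sum_nat_eq0 => /forallP/(_ c).
  have w (p : 'I_0) : C by case: p.
  exists w; split=> [[]//|c]; rewrite A0; apply/eqP; rewrite cards_eq0; apply/eqP/setP.
  by case.
have c0 : C by case: s size_s {count_s} => // c.
exists (fun p => nth c0 s p); split=> [p q lt_pq|c].
  by apply: sorted_ltn_nth => //; rewrite ?inE ?size_s //; exact: sort_sorted.
rewrite -count_word -count_s; congr (count _ _).
transitivity [seq nth c0 s k | k <- map val (enum 'I_n.+1)].
  by rewrite -map_comp.
by rewrite val_enum_ord -/(mkseq _ _) -size_s mkseq_nth.
Qed.

Lemma card_ord_below n k : (k <= n)%N -> #|[set u : 'I_n | (u < k)%N]| = k.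
Proof.
move=> le_kn; rewrite -sum1_card.
under eq_bigl do rewrite inE.
by rewrite (big_ord_narrow le_kn) sum1_card card_ord.
Qed.

Lemma perm_rank n (s : {perm 'I_n}) p : #|[set q | (s q < s p)%N]| = s p :> nat.
Proof.
rewrite -[RHS](card_ord_below (ltnW (ltn_ord (s p)))).
rewrite -[RHS](card_preimset _ (@perm_inj _ s)); apply: eq_card => q.
by rewrite !inE.
Qed.

(** pi(p) is the number of q with pi(q) < pi(p), so the relative order of the
    values is all there is to know about pi. *)
Lemma perm_rel_inj n (s s' : {perm 'I_n}) :
  (forall p q, (s q < s p)%N = (s' q < s' p)%N) -> s = s'.
Proof.
move=> eq_ss'; apply/permP => p; apply/val_inj.
rewrite /= -(perm_rank s) -(perm_rank s'); apply: eq_card => q.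
by rewrite !inE eq_ss'.
Qed.

Lemma increasing_perm1 n (s : {perm 'I_n}) :
  (forall p q : 'I_n, (p < q)%N -> (s p < s q)%N) -> s = 1%g.
Proof.
move=> s_mon; apply: perm_rel_inj => p q; rewrite !perm1.
case: (ltngtP q p) => [/s_mon // | /s_mon lt | /val_inj ->]; last by rewrite ltnn.
by apply/negbTE; rewrite -leqNgt ltnW.
Qed.

(** Standardization: rank the positions by the given strict total order. *)
Lemma perm_of_order n (r : rel 'I_n) :
    irreflexive r -> transitive r ->
    (forall p q, p != q -> r p q || r q p) ->
  exists s : {perm 'I_n}, forall p q, (s q < s p)%N = r q p.
Proof.
move=> r_irr r_tr r_tot.
have lt_rank p q : r q p -> (#|[set u | r u q]| < #|[set u | r u p]|)%N.
  move=> rqp; apply: proper_card; apply/properP; split.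
    by apply/subsetP => u; rewrite !inE => /r_tr; exact.
  by exists q; rewrite !inE ?rqp ?r_irr.
have rank_lt p : (#|[set u | r u p]| < n)%N.
  rewrite -[X in (_ < X)%N]card_ord -cardsT; apply: proper_card; apply/properP.
  by split; [exact: subsetT | exists p; rewrite !inE ?r_irr].
pose f p := Ordinal (rank_lt p).
have f_inj : injective f.
  move=> p q [eq_f]; apply/eqP; apply/negP => /negP /r_tot.
  by case/orP => /lt_rank; rewrite eq_f ltnn.
exists (perm f_inj) => p q; rewrite !permE /=.
have [/lt_rank // | nr] := boolP (r q p).
have [-> | /r_tot] := eqVneq q p; first by rewrite ltnn.
by rewrite (negbTE nr) /= => /lt_rank lt; apply/negbTE; rewrite -leqNgt ltnW.
Qed.

(** * Labeled involutions and symmetric matrices *)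

(** The condition is imposed on all pairs p < q, so that it says directly that pi
    is monotone on each block; for consecutive p, q alone it is equivalent, see
    [labeling_steps_ok]. *)
Definition labeling n m (pi : {perm 'I_n}) (f : {ffun 'I_n -> 'I_m}) : bool :=
  [forall p : 'I_n, forall q : 'I_n, (p < q)%N ==>
     (f p < f q)%N || (f p == f q :> nat) && ((pi p < pi q)%N == ~~ odd (f p))].

Section LabeledInvolutions.
Variables n m : nat.
Implicit Types (f g : {ffun 'I_n -> 'I_m}) (pi : {perm 'I_n}).
Implicit Types (i j : 'I_m) (c d : 'I_m * 'I_m) (x : {ffun 'I_n -> 'I_m} * {perm 'I_n}).

Lemma labelingP pi f :
  reflect (forall p q : 'I_n, (p < q)%N -> (f p < f q)%N \/
             (f p = f q :> nat /\ (pi p < pi q)%N = ~~ odd (f p)))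
          (labeling pi f).
Proof.
apply: (iffP forallP) => [lab p q lt_pq | lab p].
  have /forallP/(_ q) := lab p; rewrite lt_pq /=.
  by case/orP => [|/andP[/eqP ? /eqP ?]]; [left | right].
apply/forallP => q; apply/implyP => /lab [-> // | [-> ->]].
by rewrite !eqxx orbT.
Qed.

(** In a row with odd label the second letters decrease, because there pi
    decreases while the labels increase with the positions. *)
Definition key_le : rel ('I_m * 'I_m) := fun c d =>
  (c.1 < d.1)%N || (c.1 == d.1 :> nat) &&
    (if odd c.1 then d.2 <= c.2 else c.2 <= d.2)%N.

Lemma key_le_trans : transitive key_le.
Proof.
move=> [d1 d2] [c1 c2] [e1 e2]; rewrite /key_le /=.
case/orP=> [lt1 | /andP[/eqP eq1 le1]]; case/orP=> [lt2 | /andP[/eqP eq2 le2]].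
- by rewrite (ltn_trans lt1 lt2).
- by rewrite -eq2 lt1.
- by rewrite eq1 lt2.
rewrite eq1 eq2 eqxx -eq2; move: le1 le2; rewrite eq1.
by case: ifP => _ le1 le2;
  [rewrite (leq_trans le2 le1) | rewrite (leq_trans le1 le2)]; rewrite orbT.
Qed.

Lemma key_le_total : total key_le.
Proof.
move=> [c1 c2] [d1 d2]; rewrite /key_le /=.
by case: (ltngtP c1 d1) => //= ->; case: ifP => _; exact: leq_total.
Qed.

Lemma key_le_anti : antisymmetric key_le.
Proof.
move=> [c1 c2] [d1 d2]; rewrite /key_le /=.
case: (ltngtP c1 d1) => //= /val_inj ->.
by case: ifP => _; rewrite -eqn_leq => /eqP /val_inj ->.
Qed.

(** The order of positions whose ranks are the standardization of the word g:
    equal even letters are numbered from left to right, equal odd letters from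
    right to left. *)
Definition std_lt (g : 'I_n -> 'I_m) : rel 'I_n := fun q p =>
  (g q < g p)%N || (g q == g p :> nat) && (if odd (g p) then p < q else q < p)%N.

Lemma std_lt_irr (g : 'I_n -> 'I_m) : irreflexive (std_lt g).
Proof. by move=> p; rewrite /std_lt eqxx !ltnn; case: ifP. Qed.

Lemma std_lt_trans (g : 'I_n -> 'I_m) : transitive (std_lt g).
Proof.
move=> q p u; rewrite /std_lt.
case/orP=> [lt1 | /andP[/eqP eq1 le1]]; case/orP=> [lt2 | /andP[/eqP eq2 le2]].
- by rewrite (ltn_trans lt1 lt2).
- by rewrite -eq2 lt1.
- by rewrite eq1 lt2.
rewrite eq1 eq2 eqxx; move: le1 le2; rewrite eq2.
by case: ifP => _ le1 le2;
  [rewrite (ltn_trans le2 le1) | rewrite (ltn_trans le1 le2)]; rewrite orbT.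
Qed.

Lemma std_lt_total (g : 'I_n -> 'I_m) p q : p != q -> std_lt g p q || std_lt g q p.
Proof.
move=> ne_pq; rewrite /std_lt; case: (ltngtP (g p) (g q)) => //= ->.
have := ne_pq; rewrite -(inj_eq val_inj) /= neq_ltn orbC.
by case: ifP; rewrite // orbC.
Qed.

Lemma std_lt_asym (g : 'I_n -> 'I_m) p q : std_lt g p q -> ~~ std_lt g q p.
Proof. by move=> pq; apply/negP => /(std_lt_trans pq); rewrite std_lt_irr. Qed.

Definition labeled_involutions : {set {ffun 'I_n -> 'I_m} * {perm 'I_n}} :=
  [set x | (x.2 \in involutions n) && labeling x.2 x.1].

Definition class_count x c : nat := #|[set p | (x.1 p, x.1 (x.2 p)) == c]|.

Lemma sum_class_count x : (\sum_c class_count x c = n)%N.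
Proof.
rewrite -[RHS]card_ord -sum1_card.
rewrite (partition_big (fun p => (x.1 p, x.1 (x.2 p))) predT) //=.
by apply: eq_bigr => c _; rewrite /class_count -sum1_card; apply: eq_bigl => p; rewrite inE.
Qed.

Section OneInvolution.
Variables (f : {ffun 'I_n -> 'I_m}) (pi : {perm 'I_n}).
Hypothesis lab_inv : (f, pi) \in labeled_involutions.
Notation x := (f, pi).

Lemma label_invK p : pi (pi p) = p.
Proof.
move: lab_inv; rewrite inE => /andP[]; rewrite inE => /eqP pi2 _.
by rewrite -permM pi2 perm1.
Qed.

Lemma label_step (p q : 'I_n) : (p < q)%N -> (f p < f q)%N \/
  (f p = f q :> nat /\ (pi p < pi q)%N = ~~ odd (f p)).
Proof. by move: p q; apply/labelingP; move: lab_inv; rewrite inE => /andP[]. Qed.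

Lemma label_mono (p q : 'I_n) : (p <= q)%N -> (f p <= f q)%N.
Proof.
by rewrite leq_eqVlt => /predU1P[/val_inj -> // | /label_step [/ltnW | [->]]].
Qed.

Lemma label_perm_neq (p q : 'I_n) : (p < q)%N -> (pi p != pi q :> nat).
Proof.
move=> lt_pq; apply/negP => /eqP /val_inj /perm_inj eq_pq.
by rewrite eq_pq ltnn in lt_pq.
Qed.

Lemma key_mono (p q : 'I_n) :
  (p < q)%N -> key_le (f p, f (pi p)) (f q, f (pi q)).
Proof.
move=> lt_pq; rewrite /key_le /=; case: (label_step lt_pq) => [-> // | [eq_f eq_pi]].
rewrite eq_f eqxx ltnn /= -eq_f; have := label_perm_neq lt_pq.
case: ifP eq_pi => [_|_] /=.
  by case: ltngtP => // lt _ _; apply: label_mono; exact: ltnW.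
by move=> lt _; apply: label_mono; exact: ltnW.
Qed.

(** Positions u < v have f(u) <= f(v), and inside a block u < v and pi(u) < pi(v)
    are equivalent or opposite according to the parity of the label; apply this
    to u = pi(q), v = pi(p), where pi(u) = q and pi(v) = p. *)
Lemma label_std p q : (pi q < pi p)%N = std_lt (f \o pi) q p.
Proof.
have impl u v : (pi u < pi v)%N -> std_lt (f \o pi) u v.
  move=> lt; rewrite /std_lt /=; case: (label_step lt) => [-> // | [eq_f]].
  rewrite !label_invK eq_f eqxx ltnn /= => lt_uv.
  have ne_uv : u != v :> nat by apply/eqP => /val_inj eq_uv; rewrite eq_uv ltnn in lt.
  by case: ifP lt_uv => _ //; case: ltngtP ne_uv.
have [/impl // | ] := boolP (pi q < pi p)%N.
rewrite -leqNgt leq_eqVlt => /predU1P[/val_inj/perm_inj -> | /impl lt_pq].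
  by rewrite std_lt_irr.
by rewrite (negbTE (std_lt_asym lt_pq)).
Qed.

Lemma class_count_sym i j : class_count x (i, j) = class_count x (j, i).
Proof.
rewrite /class_count -[RHS](card_preimset _ (@perm_inj _ pi)).
by apply: eq_card => p; rewrite !inE /= label_invK !xpair_eqE andbC.
Qed.

(** Two positions of this class would be mapped by pi increasingly or decreasingly
    according to the parity of i, and mapped back according to that of j. *)
Lemma class_count_mixed i j :
  odd i != odd j -> (class_count x (i, j) <= 1)%N.
Proof.
move=> mixed; suff no_lt (p q : 'I_n) : (p < q)%N -> (f p, f (pi p)) = (i, j) ->
    (f q, f (pi q)) = (i, j) -> False.
  apply/card_le1_eqP => p q; rewrite !inE /= => /eqP pij /eqP qij.
  by apply/val_inj; case: (ltngtP p q) => // /no_lt; case.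
move=> lt_pq [fp fpp] [fq fpq].
case: (label_step lt_pq); rewrite fp fq ?ltnn // => -[_ eq1].
case: (ltngtP (pi p) (pi q)) eq1 => [lt eq1 | lt eq1 | /val_inj/perm_inj eq_pq].
- case: (label_step lt); rewrite fpp fpq ?ltnn // !label_invK lt_pq => -[_ eq2].
  by move: mixed eq1 eq2; do 2!case: odd.
- case: (label_step lt); rewrite fpp fpq ?ltnn // !label_invK => -[_].
  by rewrite ltnNge ltnW // => eq2; move: mixed eq1 eq2; do 2!case: odd.
by rewrite eq_pq ltnn in lt_pq.
Qed.

Definition fixed_with_label (i : 'I_m) := #|[set p | (pi p == p) && (f p == i)]|.

Lemma fix_count_by_label : fix_count pi = (\sum_i fixed_with_label i)%N.
Proof.
rewrite /fix_count -sum1_card (partition_big f predT) //=.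
apply: eq_bigr => i _; rewrite /fixed_with_label -sum1_card.
by apply: eq_bigl => p; rewrite !inE.
Qed.

(** If f(p) = f(pi(p)) = i and pi(p) differs from p, then pi exchanges two
    positions of one block, hence inverts them, although it increases there. *)
Lemma fixed_even i : ~~ odd i -> fixed_with_label i = class_count x (i, i).
Proof.
move=> ev_i; apply: eq_card => p; rewrite !inE /=.
apply/andP/eqP => [[/eqP -> /eqP ->] // | [fp fpp]]; rewrite fp eqxx; split=> //.
apply/eqP/val_inj; case: (ltngtP (pi p) p) => // lt; case: (label_step lt).
- by rewrite fp fpp ltnn.
- by rewrite fpp fp label_invK ev_i => -[_ /ltnW]; rewrite leqNgt lt.
- by rewrite fp fpp ltnn.
- by rewrite fpp fp label_invK ev_i => -[_ /ltnW]; rewrite leqNgt lt.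
Qed.

(** A decreasing map has at most one fixed point, and the other elements of the
    class are paired off by pi. *)
Lemma fixed_odd i : odd i -> fixed_with_label i = odd (class_count x (i, i)).
Proof.
move=> odd_i; pose K := [set p | (f p, f (pi p)) == (i, i)].
pose Fx := [set p | (pi p == p) && (f p == i)].
pose U := [set p in K | (p < pi p)%N]; pose D := [set p in K | (pi p < p)%N].
have Fx1 : (#|Fx| <= 1)%N.
  suff no_lt (p q : 'I_n) : (p < q)%N -> p \in Fx -> q \in Fx -> False.
    apply/card_le1_eqP => p q pF qF.
    by apply/val_inj; case: (ltngtP p q) => // /no_lt; case.
  rewrite !inE => lt_pq /andP[/eqP pp /eqP fp] /andP[/eqP qq /eqP fq].
  case: (label_step lt_pq); rewrite fp fq ?ltnn // => -[_].
  by rewrite pp qq lt_pq odd_i.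
have DU : #|D| = #|U|.
  rewrite -(card_preimset _ (@perm_inj _ pi)); apply: eq_card => p.
  by rewrite !inE /= label_invK !xpair_eqE [(f (pi p) == i) && _]andbC.
have -> : class_count x (i, i) = (#|Fx| + (#|U| + #|D|))%N.
  rewrite /class_count -/K -sum1_card (bigID [pred p | pi p == p]) /=.
  congr (_ + _)%N; first by rewrite -sum1_card; apply: eq_bigl => p;
    rewrite !inE xpair_eqE; case: (pi p =P p) => [->|]; rewrite ?andbb ?andbF ?andbT.
  rewrite (bigID [pred p : 'I_n | (p < pi p)%N]) /=; congr (_ + _)%N;
    rewrite -sum1_card; apply: eq_bigl => p; rewrite !inE -andbA; congr (_ && _);
    by rewrite -(inj_eq val_inj) /=; case: ltngtP.
rewrite DU addnn oddD odd_double addbF /fixed_with_label -/Fx.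
by case: #|Fx| Fx1 => [|[]].
Qed.

End OneInvolution.

(** The counts determine the sorted word of pairs (f(p), f(pi(p))), hence f and
    f o pi, and the latter determines pi by [label_std]. *)
Lemma class_count_inj :
  {in labeled_involutions &, forall x y, class_count x =1 class_count y -> x = y}.
Proof.
move=> [f pi] [f' pi'] xT yT eq_count.
have eq_key := sorted_word_uniq key_le_trans key_le_anti (key_mono xT) (key_mono yT) eq_count.
have eq_f : f = f' by apply/ffunP => p; have [] := eq_key p.
congr (_, _) => //; apply: perm_rel_inj => p q; rewrite (label_std xT) (label_std yT).
rewrite /std_lt /=; have eq_g u : f (pi u) = f' (pi' u) by have [] := eq_key u.
by rewrite !eq_g.
Qed.

(** Let w = (f, g) be the sorted word of pairs with multiplicities A and let pi be
    the standardization of g.  Each identity needed compares two sorted words with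
    the same counts: f = g o pi^-1 because row and column sums of A agree, and
    f o pi^-1 = g because A is symmetric.  Then pi o pi preserves the order, so it
    is the identity. *)
Lemma labeled_involution_exists (A : 'I_m * 'I_m -> nat) :
    (forall i j, A (i, j) = A (j, i)) ->
    (forall i j, odd i != odd j -> (A (i, j) <= 1)%N) ->
    (\sum_c A c = n)%N ->
  exists2 x, x \in labeled_involutions & class_count x =1 A.
Proof.
move=> A_sym A_mixed /(sorted_word_exists key_le_trans key_le_total).
case=> w [w_mono w_count]; pose f := [ffun p => (w p).1]; pose g p := (w p).2.
have w_fg p : w p = (f p, g p) by rewrite ffunE /g; case: (w p).
have [pi pi_std] := perm_of_order (@std_lt_irr g) (@std_lt_trans g) (@std_lt_total g).
have f_step (p q : 'I_n) : (p < q)%N ->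
    (f p < f q)%N \/ (f p = f q :> nat /\ (pi p < pi q)%N = ~~ odd (f p)).
  move=> lt_pq; have := w_mono _ _ lt_pq; rewrite /key_le !w_fg /=.
  case/orP => [|/andP[/eqP eq_f le_g]]; [by left | right; split=> //].
  (* Two positions in one class force equal parities, by the bound on A. *)
  have same : g p = g q -> odd (g p) = odd (f p).
    move=> eq_g; apply/eqP/negPn/negP => mixed.
    have /card_le1_eqP/(_ p q) : (#|[set p' | w p' == (f p, g p)]| <= 1)%N.
      by rewrite w_count A_mixed // eq_sym.
    rewrite !inE w_fg eqxx (w_fg q) -eq_g -(val_inj eq_f) eqxx => /(_ isT isT) eq_pq.
    by rewrite eq_pq ltnn in lt_pq.
  rewrite pi_std; case: ifP le_g => odd_f /=; rewrite leq_eqVlt.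
    move=> le_g; apply/negbTE/std_lt_asym; rewrite /std_lt.
    case/predU1P: le_g => [/val_inj eq_g | -> //].
    by rewrite -eq_g in same *; rewrite eqxx same // odd_f lt_pq orbT.
  rewrite /std_lt; case/predU1P => [/val_inj eq_g | -> //].
  by rewrite -eq_g eqxx same // odd_f lt_pq orbT.
have f_mono (p q : 'I_n) : (p <= q)%N -> (f p <= f q)%N.
  by rewrite leq_eqVlt => /predU1P[/val_inj -> // | /f_step [/ltnW | [->]]].
have f_count j : #|[set p | f p == j]| = (\sum_i A (j, i))%N.
  rewrite -sum1_card (partition_big g predT) //=; apply: eq_bigr => i _.
  rewrite -w_count -sum1_card; apply: eq_bigl => p.
  by rewrite !inE w_fg xpair_eqE.
have g_count j : #|[set p | g p == j]| = (\sum_i A (i, j))%N.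
  rewrite -sum1_card (partition_big f predT) //=; apply: eq_bigr => i _.
  rewrite -w_count -sum1_card; apply: eq_bigl => p.
  by rewrite !inE w_fg xpair_eqE andbC.
have fpi p : f (pi p) = g p.
  suff eq_gf : g \o pi^-1%g =1 f by rewrite -eq_gf /= permK.
  apply: (@sorted_word_uniq _ _ (relpre val leq)).
  - by move=> ? ? ?; exact: leq_trans.
  - by move=> i j; rewrite /= -eqn_leq => /eqP/val_inj.
  - move=> u v lt_uv /=; have := pi_std (pi^-1 v)%g (pi^-1 u)%g.
    by rewrite !permKV lt_uv => /esym /orP[/ltnW // | /andP[/eqP ->]].
  - by move=> u v /ltnW /f_mono.
  move=> j; rewrite f_count -(card_preimset _ (@perm_inj _ pi)).
  transitivity #|[set p | g p == j]|; last by rewrite g_count; apply: eq_bigr.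
  by apply: eq_card => q; rewrite !inE /= permK.
have gpi p : g (pi p) = f p.
  suff /(_ (pi p)) : (fun u => (f u, f (pi^-1%g u))) =1 w by rewrite permK w_fg => -[].
  apply: (sorted_word_uniq key_le_trans key_le_anti) => //.
    move=> u v lt_uv; pose a := (pi^-1 u)%g; pose b := (pi^-1 v)%g.
    have fu : f u = g a by rewrite -fpi permKV.
    have fv : f v = g b by rewrite -fpi permKV.
    have := pi_std b a; rewrite !permKV lt_uv => /esym.
    rewrite /key_le /= fu fv -/a -/b.
    case/orP=> [-> // | /andP[/eqP -> lt]]; rewrite eqxx ltnn /=.
    by case: ifP lt => _ /ltnW; exact: f_mono.
  case=> i j; rewrite w_count A_sym -w_count -(card_preimset _ (@perm_inj _ pi)).
  by apply: eq_card => q; rewrite !inE /= permK fpi w_fg !xpair_eqE andbC.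
exists (f, pi); last first.
  by move=> c; rewrite -w_count; apply: eq_card => p; rewrite !inE /= fpi w_fg.
rewrite inE inE /=; apply/andP; split; last exact/labelingP.
apply/eqP/increasing_perm1 => p q lt_pq; rewrite !permM pi_std /std_lt !gpi.
case: (f_step _ _ lt_pq) => [-> // | [eq_f lt_pi]].
rewrite eq_f eqxx ltnn /= -eq_f; move: lt_pi; case: ifP => //= _.
case: ltngtP => // /val_inj/perm_inj eq_pq _.
by rewrite eq_pq ltnn in lt_pq.
Qed.

End LabeledInvolutions.

(** * The series of labeled involutions as a product *)

Section FpsComplements.
Variable R : comNzRingType.
Implicit Types f g h : {fps R}.

Lemma fps_coefCM (c : R) f n : (fpsC c * f).[# n] = c * f.[# n].
Proof.
rewrite fps_coefM big_ord_recl subn0 big1 ?addr0 // => i _.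
by rewrite mul0r.
Qed.

Lemma fps_coefXM f n : (fpsX R * f).[# n] = if n is n'.+1 then f.[# n'] else 0.
Proof.
rewrite fps_coefM; case: n => [|n]; first by rewrite big_ord1 mul0r.
rewrite !big_ord_recl mul0r add0r mul1r subSS subn0 big1 ?addr0 // => i _.
by rewrite mul0r.
Qed.

Lemma fps_coefXnM k f n :
  (fpsX R ^+ k * f).[# n] = if (n < k)%N then 0 else f.[# n - k].
Proof.
elim: k n => [|k IHk] n; first by rewrite mul1r subn0.
by rewrite exprS -mulrA fps_coefXM; case: n => // n; rewrite IHk ltnS.
Qed.

Lemma fps_coefXn k n : (fpsX R ^+ k).[# n] = (n == k)%:R.
Proof.
rewrite -[_ ^+ _]mulr1 fps_coefXnM fps_coef1 subn_eq0 ltnNge.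
by rewrite [n == k]eqn_leq; case: leqP; rewrite ?andbF ?andbT.
Qed.

Definition eq_upto n f g := forall k, (k <= n)%N -> f.[# k] = g.[# k].

Lemma eq_uptoM n f f' g g' :
  eq_upto n f f' -> eq_upto n g g' -> eq_upto n (f * g) (f' * g').
Proof.
move=> ff' gg' k le_kn; apply: eq_bigr => -[i /= lt_ik] _.
by rewrite ff' ?gg' //; lia.
Qed.

Lemma eq_upto_prod n (I : Type) (r : seq I) (P : pred I) (F G : I -> {fps R}) :
  (forall i, P i -> eq_upto n (F i) (G i)) ->
  eq_upto n (\prod_(i <- r | P i) F i) (\prod_(i <- r | P i) G i).
Proof. by move=> eqFG; apply: big_ind2 => // *; exact: eq_uptoM. Qed.

End FpsComplements.

Section ChainSeries.
Variables (R : comNzRingType) (z : R).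

(** The weight of the entry a at the place (i,j), i <= j: on the diagonal the
    entry determines the number of fixed points, off the diagonal it is subject
    to the bound at places of mixed parity. *)
Definition pair_weight (i j a : nat) : R :=
  if i == j then z ^+ (if odd i then (odd a : nat) else a)
  else ((odd i == odd j) || (a <= 1)%N)%:R.

(** Off the diagonal an entry is counted at (i,j) and at (j,i). *)
Definition pair_size (i j : nat) : nat := (i != j).+1.

Definition pair_series (i j : nat) : {fps R} := Fps (fun n =>
  if i == j then pair_weight i j n
  else if odd n then 0 else pair_weight i j n./2).

Definition chain_series (m : nat) : {fps R} :=
  \prod_(c : 'I_m * 'I_m | (c.1 <= c.2)%N) pair_series c.1 c.2.

Lemma pair_series_trunc n i j : eq_upto n (pair_series i j)
  (\sum_(a < n.+1) fpsC (pair_weight i j a) * fpsX R ^+ (pair_size i j * a)).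
Proof.
move=> k le_kn; rewrite fps_coef_sum [LHS]/= /pair_size.
under eq_bigr do rewrite fps_coefCM fps_coefXn.
have [eq_ij|ne_ij] /= := eqVneq i j.
  have lt_k : (k < n.+1)%N by [].
  rewrite (bigD1 (Ordinal lt_k)) //= mul1n eqxx mulr1 big1 ?addr0 // => a.
  by rewrite -(inj_eq val_inj) /= mul1n [k == _]eq_sym => /negbTE ->; rewrite mulr0.
case: ifP => odd_k.
  rewrite big1 // => a _; case: eqP => [eq_k|]; last by rewrite mulr0.
  by move: odd_k; rewrite eq_k oddM.
have lt_k : (k./2 < n.+1)%N by lia.
rewrite (bigD1 (Ordinal lt_k)) //= big1 ?addr0 => [|a].
  by rewrite mul2n halfK odd_k subn0 eqxx mulr1.
rewrite -(inj_eq val_inj) /= => ne_a; case: eqP => [eq_k|]; last by rewrite mulr0.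
by move: ne_a; rewrite eq_k mul2n doubleK eqxx.
Qed.

Lemma sum_symmetric m (A : 'I_m * 'I_m -> nat) :
    (forall i j, A (i, j) = A (j, i)) ->
  (\sum_c A c = \sum_(c : 'I_m * 'I_m | (c.1 <= c.2)%N) pair_size c.1 c.2 * A c)%N.
Proof.
move=> A_sym; rewrite (bigID [pred c : 'I_m * 'I_m | (c.1 <= c.2)%N]) /=.
pose swap (c : 'I_m * 'I_m) := (c.2, c.1).
have swapK : involutive swap by case.
rewrite [X in (_ + X)%N](reindex_inj (inv_inj swapK)) /=.
rewrite [X in (X + _)%N]big_mkcond [X in (_ + X)%N]big_mkcond [RHS]big_mkcond.
rewrite -big_split; apply: eq_bigr => -[i j] _ /=; rewrite /pair_size -ltnNge.
by case: ltngtP => _ //=; rewrite ?(A_sym j i); lia.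
Qed.

Section Count.
Variables (n m : nat).
Notation pairs := ('I_m * 'I_m)%type.
Implicit Types (x : {ffun 'I_n -> 'I_m} * {perm 'I_n}) (a : {ffun pairs -> 'I_n.+1}).

Definition class_table x : {ffun pairs -> 'I_n.+1} :=
  [ffun c : pairs => if (c.1 <= c.2)%N then inord (class_count x c) else ord0].

Definition admissible_table a : bool :=
  [&& [forall c : pairs, (c.1 <= c.2)%N || (a c == ord0)],
      [forall c : pairs, (odd c.1 != odd c.2) ==> (a c <= 1)%N] &
      n == (\sum_(c : pairs | (c.1 <= c.2)%N) pair_size c.1 c.2 * a c)%N].

Lemma class_count_le x c : (class_count x c <= n)%N.
Proof. by rewrite -[X in (_ <= X)%N](sum_class_count x) (bigD1 c) //= leq_addr. Qed.

Lemma class_tableE x (c : pairs) : (c.1 <= c.2)%N ->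
  class_table x c = class_count x c :> nat.
Proof. by move=> le_c; rewrite ffunE le_c inordK // ltnS class_count_le. Qed.

Lemma class_table_inj : {in labeled_involutions n m &, injective class_table}.
Proof.
move=> [f pi] [f' pi'] xT yT eq_table; apply: (class_count_inj xT yT) => -[i j].
wlog le_ij : i j / (i <= j)%N.
  move=> IH; case: (leqP i j) => [|/ltnW] /IH // eq_ji.
  by rewrite (class_count_sym xT) (class_count_sym yT).
by rewrite -!class_tableE // eq_table.
Qed.

(** The upper triangle of a symmetric matrix is free, so admissible tables are
    extended by symmetry before [labeled_involution_exists] applies. *)
Lemma class_table_image :
  class_table @: labeled_involutions n m = [set a | admissible_table a].
Proof.
apply/setP => a; rewrite inE; apply/imsetP/and3P.
  case=> -[f pi] xT ->; split.
  - by apply/forallP => c; rewrite ffunE; case: leqP.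
  - apply/forallP => -[i j]; apply/implyP => /= mixed; rewrite ffunE /=.
    case: ifP => // _; rewrite inordK ?ltnS ?class_count_le //.
    exact: class_count_mixed.
  rewrite -{1}(sum_class_count (f, pi)) sum_symmetric; last exact: class_count_sym.
  by apply/eqP; apply: eq_bigr => c le_c; rewrite class_tableE.
case=> /forallP a_supp /forallP a_mixed /eqP a_sum.
pose A (c : pairs) : nat := if (c.1 <= c.2)%N then a c else a (c.2, c.1).
have A_sym i j : A (i, j) = A (j, i).
  by rewrite /A /=; case: (ltngtP i j) => // /val_inj ->.
have A_mixed (i j : 'I_m) : odd i != odd j -> (A (i, j) <= 1)%N.
  rewrite /A /= => mixed; case: ifP => _.
    by have /implyP := a_mixed (i, j); apply.
  by have /implyP := a_mixed (j, i); apply; rewrite eq_sym.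
have A_sum : (\sum_c A c = n)%N.
  rewrite sum_symmetric // a_sum; apply: eq_bigr => c le_c.
  by rewrite /A le_c.
have [x xT xA] := labeled_involution_exists A_sym A_mixed A_sum.
exists x => //; apply/ffunP => c; apply/val_inj.
case: (leqP c.1 c.2) => [le_c | lt_c]; first by rewrite /= class_tableE // xA /A le_c.
rewrite ffunE leqNgt lt_c /=; have := a_supp c; rewrite leqNgt lt_c /=.
by move/eqP ->.
Qed.

Lemma class_table_weight x : x \in labeled_involutions n m ->
  \prod_(c : pairs | (c.1 <= c.2)%N) pair_weight c.1 c.2 (class_table x c) =
    z ^+ fix_count x.2.
Proof.
case: x => f pi xT; rewrite (fix_count_by_label f pi) expr_sum.
transitivity (\prod_(i < m) \prod_(j < m | (i <= j)%N)
    pair_weight i j (class_count (f, pi) (i, j))).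
  rewrite pair_big_dep /=; apply: eq_bigr => -[i j] le_ij.
  by rewrite class_tableE.
apply: eq_bigr => i _; rewrite (bigD1 i) //= big1 ?mulr1 => [|j /andP[le_ij ne_ij]].
  rewrite /pair_weight eqxx; case: ifP => odd_i; first by rewrite (fixed_odd xT).
  by rewrite (fixed_even xT) ?odd_i.
rewrite /pair_weight; have -> : (i == j :> nat) = false.
  by apply/negbTE; rewrite eq_sym.
have [//|mixed] := boolP (odd i == odd j).
by rewrite (class_count_mixed xT mixed).
Qed.

(** Expanding the product of truncated factors gives a sum over tables; tables
    violating the mixed-parity bound have weight zero, and the remaining ones are
    the images of the labeled involutions. *)
Lemma chain_series_coef :
  (chain_series m).[# n] = \sum_(x in labeled_involutions n m) z ^+ fix_count x.2.
Proof.
have trunc (c : pairs) (_ : (c.1 <= c.2)%N) := @pair_series_trunc n c.1 c.2.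
rewrite (eq_upto_prod _ trunc (leqnn n)).
rewrite (big_distr_big ord0) fps_coef_sum /=.
transitivity (\sum_(a | admissible_table a)
    \prod_(c : pairs | (c.1 <= c.2)%N) pair_weight c.1 c.2 (a c)); last first.
  rewrite -(eq_bigl _ _ (fun a => in_set _ a)) -class_table_image.
  rewrite (big_imset _ class_table_inj); apply: eq_bigr => x.
  exact: class_table_weight.
rewrite big_mkcond [RHS]big_mkcond; apply: eq_bigr => a _.
rewrite big_split -rmorph_prod -expr_sum fps_coefCM fps_coefXn /=.
have -> : (a \in pffun_on ord0 (fun c : pairs => (c.1 <= c.2)%N) (fun=> true)) =
          [forall c : pairs, (c.1 <= c.2)%N || (a c == ord0)].
  apply/pffun_onP/forallP => [[/subsetP supp _] c | supp]; last first.
    split=> //; apply/subsetP => c; rewrite inE => ac.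
    by have := supp c; rewrite (negbTE ac) orbF.
  by rewrite orbC -implyNb; apply/implyP => ac; exact: supp.
rewrite /admissible_table; case: ifP => //= /forallP supp.
case: (n == _); rewrite ?andbF ?andbT ?mulr0 // mulr1.
case: ifPn => // /forallPn[c]; rewrite negb_imply -ltnNge => /andP[mixed lt_1a].
have le_c : (c.1 <= c.2)%N.
  by case/orP: (supp c) => // /eqP ac; rewrite ac in lt_1a.
rewrite (bigD1 c) //= /pair_weight.
have -> : (c.1 == c.2 :> nat) = false.
  by apply/eqP => eq_c; rewrite eq_c eqxx in mixed.
by rewrite (negbTE mixed) leqNgt lt_1a mul0r.
Qed.

End Count.
End ChainSeries.

(** * Closed forms of the products *)

Section ClosedForm.
Variables (R : comUnitRingType) (z : R).
Notation x := (fpsX R).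
Notation zx := (fpsC z * x).

Lemma unit_1sub (f : {fps R}) : f.[# 0] = 0 -> 1 - f \is a GRing.unit.
Proof. by move=> f0; rewrite fps_unitE fps_coefB f0 subr0 unitr1. Qed.

Lemma unit_1zx : 1 - zx \is a GRing.unit.
Proof. by apply: unit_1sub; rewrite fps_coefCM mulr0. Qed.

Lemma unit_1x2 : 1 - x ^+ 2 \is a GRing.unit.
Proof. by apply: unit_1sub; rewrite fps_coefXn. Qed.

Lemma fps_coef_x2M (f : {fps R}) n :
  (x ^+ 2 * f).[# n] = if n is n'.+2 then f.[# n'] else 0.
Proof. by rewrite fps_coefXnM; case: n => [|[|n]] //; rewrite subSS subSS subn0. Qed.

Lemma pair_series_diag_even i : ~~ odd i -> pair_series z i i = (1 - zx)^-1.
Proof.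
move=> ev_i; apply: (mulrI unit_1zx); rewrite divrr ?unit_1zx //.
apply/fpsP => n; rewrite mulrBl mul1r -mulrA fps_coefB fps_coefCM fps_coefXM fps_coef1.
rewrite /= eqxx /pair_weight eqxx (negbTE ev_i).
by case: n => [|n]; rewrite ?mulr0 ?subr0 // -exprS subrr.
Qed.

Lemma pair_series_diag_odd i :
  odd i -> pair_series z i i = (1 + zx) / (1 - x ^+ 2).
Proof.
move=> odd_i; apply: (mulIr unit_1x2); rewrite divrK ?unit_1x2 //.
apply/fpsP => n; rewrite mulrC mulrBl mul1r fps_coefB fps_coef_x2M fps_coefD.
rewrite fps_coefCM fps_coef1 fps_coefX /= eqxx /pair_weight eqxx odd_i.
case: n => [|[|n]] /=; rewrite ?mulr0 ?mulr1 ?subr0 ?addr0 ?add0r //.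
by rewrite negbK subrr.
Qed.

Lemma inv_1x2E : (1 - x ^+ 2)^-1 = Fps (fun n => (~~ odd n)%:R).
Proof.
apply: (mulrI unit_1x2); rewrite divrr ?unit_1x2 //.
apply/fpsP => n; rewrite mulrBl mul1r fps_coefB fps_coef_x2M fps_coef1.
by case: n => [|[|n]] /=; rewrite ?subr0 // negbK subrr.
Qed.

Lemma pair_series_same i j :
  i != j -> odd i = odd j -> pair_series z i j = (1 - x ^+ 2)^-1.
Proof.
move=> ne_ij eq_ij; rewrite inv_1x2E; apply/fpsP => n.
by rewrite /= (negbTE ne_ij) /pair_weight (negbTE ne_ij) eq_ij eqxx; case: odd.
Qed.

Lemma pair_series_mixed i j : odd i != odd j -> pair_series z i j = 1 + x ^+ 2.
Proof.
move=> mixed; have ne_ij : (i == j) = false by apply: contra_neqF mixed => /eqP ->.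
apply/fpsP => n; rewrite fps_coefD fps_coef1 fps_coefXn /= /pair_weight ne_ij.
rewrite (negbTE mixed) /=; case: n => [|[|[|[|n]]]] //=; rewrite ?addr0 ?add0r //.
by case: (~~ ~~ odd n).
Qed.

Lemma chain_series_recr m :
  chain_series z m.+1 = chain_series z m * \prod_(i < m.+1) pair_series z i m.
Proof.
(* The places (i,j) with i <= j, taken column by column. *)
have chainE k : chain_series z k = \prod_(j < k) \prod_(i < j.+1) pair_series z i j.
  rewrite /chain_series.
  transitivity (\prod_(i < k) \prod_(j < k | (i <= j)%N) pair_series z i j).
    by rewrite pair_big_dep.
  rewrite (exchange_big_dep predT) //=; apply: eq_bigr => j _.
  under eq_bigl do rewrite -ltnS.
  by rewrite (big_ord_narrow (ltn_ord j)).
by rewrite !chainE big_ord_recr.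
Qed.

(** Among 2k letters different from j, exactly k have the parity of j. *)
Lemma prod_pair_series_even k j : (k.*2 <= j)%N ->
  \prod_(i < k.*2) pair_series z i j = ((1 + x ^+ 2) / (1 - x ^+ 2)) ^+ k.
Proof.
elim: k => [|k IHk] le_kj; first by rewrite big_ord0.
rewrite doubleS !big_ord_recr /= IHk; last by lia.
rewrite -[LHS]mulrA [RHS]exprSr; congr (_ * _).
have [odd_j|ev_j] := boolP (odd j).
  rewrite pair_series_mixed ?pair_series_same //=; try by rewrite ?odd_double ?odd_j.
  by move: le_kj; lia.
rewrite mulrC pair_series_mixed ?pair_series_same //=; try by rewrite ?odd_double ?(negbTE ev_j).
by move: le_kj; lia.
Qed.

Lemma chain_series_odd k : chain_series z k.*2.+1 =
  chain_series z k.*2 * ((1 + x ^+ 2) ^+ k / ((1 - zx) * (1 - x ^+ 2) ^+ k)).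
Proof.
rewrite chain_series_recr big_ord_recr /= prod_pair_series_even //.
rewrite pair_series_diag_even ?odd_double // invrM ?unitrX ?unit_1zx ?unit_1x2 //.
by congr (_ * _); rewrite exprMn exprVn mulrA.
Qed.

Lemma chain_series_even k : chain_series z k.*2 =
  ((1 + zx) ^+ k * (1 + x ^+ 2) ^+ (k ^ 2)) /
  ((1 - zx) ^+ k * (1 - x ^+ 2) ^+ (k ^ 2)).
Proof.
rewrite invrM ?unitrX ?unit_1zx ?unit_1x2 // -!exprVn.
elim: k => [|k IHk].
  by rewrite /chain_series big1 ?mulr1 // => -[[]].
rewrite doubleS chain_series_recr chain_series_odd IHk 2!big_ord_recr /=.
rewrite prod_pair_series_even ?leqnSn //.
rewrite pair_series_mixed ?pair_series_diag_odd /= ?odd_double //.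
rewrite invrM ?unitrX ?unit_1zx ?unit_1x2 // -!exprVn exprMn.
have -> : (k.+1 ^ 2 = k ^ 2 + k + k + 1)%N by lia.
move: (_^-1) (_^-1) (1 + zx) (1 + x ^+ 2) => u v a b; rewrite !exprD !exprS.
by ring.
Qed.

End ClosedForm.

(** * Labelings of a fixed permutation *)

(** A function on all of nat, so that the steps of a permutation can be studied
    by recursion on the length. *)
Definition ascent n (pi : {perm 'I_n}) (i : nat) : bool :=
  [exists p : 'I_n, exists q : 'I_n,
     [&& p == i :> nat, q == i.+1 :> nat & (pi p < pi q)%N]].

(** The fictitious step before the first one is an ascent, as the letter [pi(1)]
    counts as a run of its own exactly when the first step is a descent. *)
Definition previous_step (b : nat -> bool) (i : nat) : bool :=
  if i is i'.+1 then b i' else true.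

Lemma ascentE n (pi : {perm 'I_n}) (p q : 'I_n) :
  q = p.+1 :> nat -> ascent pi p = (pi p < pi q)%N.
Proof.
move=> eq_q; apply/existsP/idP => [[p' /existsP[q' /and3P[/eqP/val_inj -> /eqP eq_q']]] | lt].
  by have -> : q' = q by apply: val_inj; rewrite /= eq_q' -eq_q.
by exists p; apply/existsP; exists q; rewrite eq_q lt !eqxx.
Qed.

Section CountLabelings.
Variable b : nat -> bool.

Definition step_ok (k i j : nat) : bool :=
  (i < j)%N || (i == j) && (b k == ~~ odd j).

Definition steps_ok n m (f : {ffun 'I_n -> 'I_m}) : bool :=
  [forall p : 'I_n, forall q : 'I_n, (q == p.+1 :> nat) ==> step_ok p (f p) (f q)].

(** The number of labelings of n+1 positions whose last label is j, by the value
    of the label before it; see [last_label_countP]. *)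
Fixpoint last_label_count (n j : nat) : nat :=
  if n is n'.+1 then
    \sum_(i < j) last_label_count n' i + (b n' == ~~ odd j) * last_label_count n' j
  else 1.

Lemma last_label_countP n m (j : 'I_m) :
  #|[set f : {ffun 'I_n.+1 -> 'I_m} | steps_ok f && (f ord_max == j)]|
    = last_label_count n j.
Proof.
elim: n j => [|n IHn] j.
  transitivity #|[set [ffun _ : 'I_1 => j]]|; last by rewrite cards1.
  apply: eq_card => f; rewrite !inE.
  apply/andP/eqP => [[_ /eqP fj] | ->].
    by apply/ffunP => p; rewrite ffunE -fj (ord1 p); congr (f _); apply/val_inj.
  rewrite ffunE; split=> //; apply/forallP => -[p lt_p]; apply/forallP => -[q lt_q].
  by apply/implyP => /eqP /=; lia.
(* [ext g] appends the last label j to g. *)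
pose ext (g : {ffun 'I_n.+1 -> 'I_m}) : {ffun 'I_n.+2 -> 'I_m} :=
  [ffun p => if unlift ord_max p is Some p' then g p' else j].
have extL g p : ext g (lift ord_max p) = g p by rewrite ffunE liftK.
have extM g : ext g ord_max = j by rewrite ffunE unlift_none.
have ext_inj : injective ext.
  by move=> g g' eq_g; apply/ffunP => p; rewrite -!extL eq_g.
pose E := [set g : {ffun 'I_n.+1 -> 'I_m} | steps_ok g && step_ok n (g ord_max) j].
transitivity #|ext @: E|.
  apply: eq_card => f; rewrite inE; apply/andP/imsetP.
    case=> /forallP f_ok /eqP fj; exists [ffun p => f (lift ord_max p)].
      rewrite inE; apply/andP; split.
        apply/forallP => p; apply/forallP => q; rewrite !ffunE.
        by have /forallP/(_ (lift ord_max q)) := f_ok (lift ord_max p); rewrite !lift_max.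
      have /forallP/(_ ord_max) := f_ok (lift ord_max ord_max).
      by rewrite lift_max eqxx /= fj ffunE.
    apply/ffunP => p; rewrite ffunE; case: unliftP => [p' ->|->] //.
    by rewrite ffunE.
  case=> g; rewrite inE => /andP[/forallP g_ok g_last] ->; rewrite extM eqxx.
  split=> //; apply/forallP => p; apply/forallP => q; apply/implyP => /eqP.
  case: (unliftP ord_max p) => [p' ->|->]; last by move=> /= eq_q; have := ltn_ord q; lia.
  case: (unliftP ord_max q) => [q' ->|->]; rewrite ?extL ?extM !lift_max => eq_q.
    by have /forallP/(_ q') := g_ok p'; rewrite eq_q eqxx.
  have -> : p' = ord_max by apply/val_inj; case: eq_q.
  exact: g_last.
rewrite card_imset //= -sum1_card.
rewrite (partition_big (fun g : {ffun 'I_n.+1 -> 'I_m} => g ord_max) predT) //=.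
transitivity (\sum_(i < m) step_ok n i j * last_label_count n i)%N.
  apply: eq_bigr => i _; rewrite -IHn.
  have [ok|nok] := boolP (step_ok n i j); last first.
    rewrite big1 ?mul0n // => g; rewrite inE => /andP[/andP[_ ok] /eqP gi].
    by move: ok; rewrite gi (negbTE nok).
  rewrite mul1n -sum1_card; apply: eq_bigl => g; rewrite !inE -andbA.
  by case: eqP => [->|]; rewrite ?andbF ?ok.
rewrite (bigID [pred i : 'I_m | (i < j)%N]) /=; congr (_ + _)%N.
  rewrite (big_ord_narrow (ltnW (ltn_ord j))) /=; apply: eq_bigr => i _.
  by rewrite /step_ok /= ltn_ord mul1n.
rewrite (bigD1 j) ?ltnn //= big1 ?addn0 => [|i /andP[ge_ij ne_ij]].
  by rewrite /step_ok ltnn eqxx.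
by rewrite /step_ok (negbTE ge_ij) (_ : (i == j :> nat) = false) //; apply/negbTE.
Qed.

Lemma card_steps_ok n m :
  #|[set f : {ffun 'I_n.+1 -> 'I_m} | steps_ok f]| =
  (\sum_(j < m) last_label_count n j)%N.
Proof.
rewrite -sum1_card.
rewrite (partition_big (fun g : {ffun 'I_n.+1 -> 'I_m} => g ord_max) predT) //=.
apply: eq_bigr => j _; rewrite -last_label_countP -sum1_card.
by apply: eq_bigl => f; rewrite !inE.
Qed.

End CountLabelings.

(** If f(p) = f(q) then all labels between are equal, and pi is monotone from p to
    q because every step goes in the direction that this label prescribes. *)
Lemma labeling_steps_ok n m (pi : {perm 'I_n}) (f : {ffun 'I_n -> 'I_m}) :
  labeling pi f = steps_ok (ascent pi) f.
Proof.
have stepE (p q : 'I_n) : q = p.+1 :> nat -> step_ok (ascent pi) p (f p) (f q) =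
   (f p < f q)%N || (f p == f q :> nat) && ((pi p < pi q)%N == ~~ odd (f p)).
  by move=> eq_q; rewrite /step_ok (ascentE pi eq_q); case: eqP => [->|].
apply/idP/idP => [/labelingP lab | /forallP ok].
  apply/forallP => p; apply/forallP => q; apply/implyP => /eqP eq_q.
  rewrite stepE //; have lt_pq : (p < q)%N by rewrite eq_q.
  by case: (lab p q lt_pq) => [-> // | [-> ->]]; rewrite !eqxx orbT.
have ok1 (p q : 'I_n) : q = p.+1 :> nat -> (f p < f q)%N \/
   (f p = f q :> nat /\ (pi p < pi q)%N = ~~ odd (f p)).
  move=> eq_q; have /forallP/(_ q) := ok p; rewrite eq_q eqxx stepE //=.
  by case/orP => [|/andP[/eqP ? /eqP ?]]; [left | right].
apply/labelingP => p q; move: {2}(q - p.+1)%N (erefl (q - p.+1)%N) => d.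
elim: d q => [|d IHd] q eq_d lt_pq; first by apply: ok1; lia.
have lt_r : (q.-1 < n)%N by have := ltn_ord q; lia.
pose r := Ordinal lt_r.
have qr : q = r.+1 :> nat by rewrite /=; lia.
have := ok1 _ _ qr; have /IHd : (r - p.+1)%N = d by rewrite /=; lia.
have lt_pr : (p < r)%N by rewrite /=; lia.
have p_r : (pi p != pi r :> nat).
  by apply/eqP => /val_inj/perm_inj eq_pr; rewrite eq_pr ltnn in lt_pr.
have r_q : (pi r != pi q :> nat).
  by apply/eqP => /val_inj/perm_inj /(congr1 val) /= eq_rq; move: qr => /=; lia.
case/(_ lt_pr) => [lt1 | [eq1 pr]] [lt2 | [eq2 rq]].
- by left; exact: ltn_trans lt2.
- by left; rewrite -eq2.
- by left; rewrite eq1.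
right; rewrite eq1 eq2; split=> //; move: pr rq; rewrite -eq2 -eq1.
by case: (odd (f p)) => /=; lia.
Qed.

(** * Transfer along the steps of a permutation *)

Section LabelSeries.
Variables (R : comUnitRingType) (b : nat -> bool).
Notation t := (fpsX R).

Lemma unit_1t : 1 - t \is a GRing.unit.
Proof. exact: unit_1sub. Qed.

Lemma unit_1pt2 : 1 + t ^+ 2 \is a GRing.unit.
Proof.
by rewrite -[t ^+ 2]opprK unit_1sub // fps_coefN fps_coefXn oppr0.
Qed.

Definition partial_sums (F : nat -> nat) : {fps R} :=
  Fps (fun n => (\sum_(i < n) F i)%:R).

Lemma partial_sumsE F :
  partial_sums F = t / (1 - t) * Fps (fun n => (F n)%:R).
Proof.
apply: (mulrI unit_1t); rewrite mulrA mulrCA divrr ?unit_1t // mulr1.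
apply/fpsP => n; rewrite mulrBl mul1r fps_coefB !fps_coefXM /=.
case: n => [|n]; first by rewrite big_ord0 subr0.
by rewrite big_ord_recr natrD addrC addKr.
Qed.

(** Oddness ([e = true]) or evenness ([e = false]) as a function of t. *)
Definition has_parity (e : bool) (f : {fps R}) :=
  forall n, odd n != e -> f.[# n] = 0.

Lemma has_parityM e e' f g :
  has_parity e f -> has_parity e' g -> has_parity (e (+) e') (f * g).
Proof.
move=> fP gP n n_par; rewrite fps_coefM big1 // => -[i /= lt_i] _.
have [i_par|/fP ->] := boolP (odd i == e); last by rewrite mul0r.
rewrite gP ?mulr0 // oddB //; move: n_par; rewrite -(eqP i_par).
by clear; do 2!case: odd; case: e'.
Qed.

Lemma has_parityD e f g :
  has_parity e f -> has_parity e g -> has_parity e (f + g).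
Proof. by move=> fP gP n n_par; rewrite fps_coefD fP ?gP ?addr0. Qed.

Lemma has_parityXn k : has_parity (odd k) (t ^+ k).
Proof. move=> n n_par; rewrite fps_coefXn.
by have -> : (n == k) = false by apply: contraNF n_par => /eqP ->. Qed.

Lemma has_parity_inv_1t2 : has_parity false (1 - t ^+ 2)^-1.
Proof. by move=> n; rewrite inv_1x2E /=; case: odd. Qed.

Definition turn (i : nat) : bool := b i != previous_step b i.

Definition step_factor (i : nat) : {fps R} :=
  if turn i then 2%:R * t else 1 + t ^+ 2.

(** The product of the scalar products met on the way, the factor
    1/(1-t^2) coming with each of the n+1 positions. *)
Fixpoint transfer_series (n : nat) : {fps R} :=
  if n is n'.+1 then transfer_series n' * (step_factor n' / (1 - t ^+ 2))
  else (1 - t ^+ 2)^-1.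

Lemma transfer_series_parity n :
  has_parity (~~ previous_step b n) (transfer_series n).
Proof.
elim: n => [|n IHn] /=; first exact: has_parity_inv_1t2.
have step_par : has_parity (turn n) (step_factor n).
  rewrite /step_factor; case: (turn n); last first.
    by apply: has_parityD; [exact: (@has_parityXn 0) | exact: (@has_parityXn 2)].
  rewrite mulr_natl mulr2n.
  by apply: has_parityD; exact: (@has_parityXn 1).
have := has_parityM IHn (has_parityM step_par has_parity_inv_1t2).
by rewrite /turn; case: (b n) (previous_step b n) => [] [].
Qed.

(** After an ascent the even and odd parts of the series are in the proportion
    1 : t, after a descent t : 1.  Both cases read R(t)(1+t), with R even after an
    ascent and odd after a descent, which is why the parity of R is tracked. *)
Lemma last_label_series n :
  Fps (fun j => (last_label_count b n j)%:R) = transfer_series n * (1 + t).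
Proof.
elim: n => [|n IHn] /=.
  apply: (mulrI (unit_1x2 R)); rewrite mulrA divrr ?unit_1x2 // mul1r.
  apply/fpsP => n; rewrite mulrBl mul1r fps_coefB fps_coef_x2M fps_coefD fps_coef1 fps_coefX /=.
  by case: n => [|[|n]]; rewrite /= ?subr0 ?addr0 ?add0r ?subrr.
set Rn := transfer_series n in IHn *.
(* Labels that stay at j: they select one of the two parts of R(t)(1+t). *)
have stayE : Fps (fun j => ((b n == ~~ odd j) * last_label_count b n j)%:R) =
    Rn * (if turn n then t else 1).
  apply/fpsP => j; rewrite [LHS]/= natrM.
  have -> : (last_label_count b n j)%:R = (Rn * (1 + t)).[# j] by rewrite -IHn.
  have RnP := @transfer_series_parity n; rewrite -/Rn in RnP.
  rewrite mulrDr mulr1 fps_coefD [Rn * t]mulrC /turn.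
  have RtP := has_parityM (@has_parityXn 1) RnP; rewrite expr1 /= in RtP.
  have stay_or_0 e u v : (e = ~~ odd j -> u = v) -> (e <> ~~ odd j -> v = 0) ->
      (e == ~~ odd j)%:R * u = v :> R.
    by case: eqP => [? uv _ | ? _ v0]; rewrite ?mul1r ?mul0r ?uv ?v0.
  apply: stay_or_0 => eq_j; case: ifPn => [ne_b | /negPn/eqP eq_b].
  - rewrite RnP ?add0r 1?mulrC //.
    by move: ne_b; rewrite eq_j; case: odd; case: previous_step.
  - by rewrite mulr1 RtP ?addr0 // -eq_b eq_j negbK; case: odd.
  - rewrite mulrC RtP //; apply/eqP => eq_j'; apply: eq_j.
    by move: ne_b; rewrite eq_j'; case: (b n); case: previous_step.
  by rewrite mulr1 RnP // -eq_b; apply/eqP => eq_j'; rewrite eq_j' negbK in eq_j.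
have -> : Fps (fun j => (\sum_(i < j) last_label_count b n i +
      (b n == ~~ odd j) * last_label_count b n j)%:R) =
    partial_sums (last_label_count b n) + Rn * (if turn n then t else 1).
  by rewrite -stayE; apply/fpsP => j; rewrite fps_coefD /= natrD.
rewrite partial_sumsE IHn; apply: (mulrI unit_1t); rewrite mulrDr.
have -> : (1 - t) * (t / (1 - t) * (Rn * (1 + t))) = t * (Rn * (1 + t)).
  transitivity ((1 - t) / (1 - t) * (t * (Rn * (1 + t)))); first by ring.
  by rewrite divrr ?unit_1t // mul1r.
have -> : (1 - t) * (Rn * (step_factor n / (1 - t ^+ 2)) * (1 + t)) =
   Rn * step_factor n * ((1 - t ^+ 2) / (1 - t ^+ 2)) by ring.
rewrite divrr ?unit_1x2 // /step_factor; case: (turn n); ring.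
Qed.

Definition turn_count n : nat := (\sum_(i < n) turn i)%N.

Lemma transfer_seriesE n :
  transfer_series n = (1 + t ^+ 2) ^+ n / (1 - t ^+ 2) ^+ n.+1 *
    (2%:R * t / (1 + t ^+ 2)) ^+ turn_count n.
Proof.
rewrite -exprVn /turn_count.
elim: n => [|n IHn] /=; first by rewrite big_ord0 mul1r mulr1.
have -> : step_factor n = (1 + t ^+ 2) * (2%:R * t / (1 + t ^+ 2)) ^+ turn n.
  rewrite /step_factor; case: (turn n); last by rewrite mulr1.
  by rewrite [RHS]mulrC divrK // unit_1pt2.
rewrite IHn big_ord_recr exprD !exprS /=.
by ring.
Qed.

Lemma label_series_closed n : 2%:R \is a @GRing.unit R ->
  partial_sums (last_label_count b n) =
   1 / (2%:R * (1 - t) ^+ 2) * ((1 + t ^+ 2) ^+ n.+1 / (1 - t ^+ 2) ^+ n *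
     (2%:R * t / (1 + t ^+ 2)) ^+ (turn_count n).+1).
Proof.
move=> unit2; have unit2f : (2%:R : {fps R}) \is a GRing.unit.
  by rewrite -[2%:R](rmorph_nat (@fpsC R)) fps_unitE.
rewrite partial_sumsE last_label_series transfer_seriesE.
set r := 2%:R * t / (1 + t ^+ 2).
have rE : (1 + t ^+ 2) * r = 2%:R * t by rewrite mulrC /r divrK // unit_1pt2.
have factor : 1 - t ^+ 2 = (1 - t) * (1 + t) by ring.
have unit_1pt : 1 + t \is a GRing.unit.
  by move: (unit_1x2 R); rewrite factor unitrM => /andP[].
have vE : (1 - t ^+ 2)^-1 = (1 + t)^-1 * (1 - t)^-1.
  by rewrite factor invrM // unit_1t.
rewrite mul1r invrM ?unitrX ?unit_1t // -!exprVn [_ ^+ n.+1 in LHS]exprS {1}vE.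
rewrite [_ ^+ n.+1 in RHS]exprS [r ^+ _.+1]exprS.
have unit2E := divrr unit2f; have unit1pE := divrr unit_1pt.
move: (1 - t ^+ 2)^-1 (r ^+ turn_count n) => V rc.
move: (1 - t)^-1 ((1 + t ^+ 2) ^+ n) (V ^+ n) => u e Vn.
transitivity (t * u ^+ 2 * (e * Vn * rc) * ((1 + t) / (1 + t))); first by ring.
transitivity (u ^+ 2 / 2%:R * (e * Vn * rc) * ((1 + t ^+ 2) * r)); last by ring.
rewrite rE unit1pE mulr1.
transitivity (2%:R / 2%:R * (t * u ^+ 2 * (e * Vn * rc))); last by ring.
by rewrite unit2E mul1r.
Qed.

End LabelSeries.

(** * Up-down runs and turns *)

Section CountRuns.
Variables (n : nat) (pi : {perm 'I_n}).
Notation b := (ascent pi).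

Definition monotone_on (e : bool) (a c : 'I_n) : bool :=
  if e then increasing_on pi a c else decreasing_on pi a c.

Lemma monotone_onP e (a c : 'I_n) :
  reflect (forall i, (a <= i < c)%N -> b i = e) (monotone_on e a c).
Proof.
have monoE : monotone_on e a c = [forall i : 'I_n, forall j : 'I_n,
    [&& a <= i, i < j & j <= c]%N ==> if e then (pi i < pi j)%N else (pi j < pi i)%N].
  by rewrite /monotone_on; case: e.
rewrite monoE; apply: (iffP forallP) => [mono i /andP[le_ai lt_ic] | steps i].
  have lt_in : (i < n)%N by have := ltn_ord c; lia.
  have lt_jn : (i.+1 < n)%N by have := ltn_ord c; lia.
  have /forallP/(_ (Ordinal lt_jn)) := mono (Ordinal lt_in).
  rewrite /= le_ai ltnSn lt_ic /=.
  rewrite (@ascentE _ pi (Ordinal lt_in) (Ordinal lt_jn)) //.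
  by case: e {mono monoE} => // /ltnW; rewrite leqNgt => /negbTE.
apply/forallP => j; apply/implyP => /and3P[le_ai lt_ij le_jc].
move: {2}(j - i.+1)%N (erefl (j - i.+1)%N) => d.
elim: d j lt_ij le_jc => [|d IHd] j lt_ij le_jc eq_d.
  have eq_j : j = i.+1 :> nat by lia.
  have := steps i; rewrite (ascentE pi eq_j) le_ai -eq_j le_jc => /(_ isT).
  have ne_ij : (pi i != pi j :> nat).
    by apply/eqP => /val_inj/perm_inj eq_ij; rewrite eq_ij ltnn in lt_ij.
  by case: e {steps monoE}; lia.
have lt_r : (j.-1 < n)%N by have := ltn_ord j; lia.
pose r := Ordinal lt_r; have eq_j : j = r.+1 :> nat by rewrite /=; lia.
have lt_ir : (i < r)%N by rewrite /=; lia.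
have le_rc : (r <= c)%N by rewrite /=; lia.
have eq_r : (r - i.+1)%N = d by rewrite /=; lia.
have := IHd r lt_ir le_rc eq_r; have := steps r.
rewrite (ascentE pi eq_j) -eq_j le_jc (ltnW (leq_ltn_trans le_ai lt_ir)) => /(_ isT).
have ne_rj : (pi r != pi j :> nat).
  by apply/eqP => /val_inj/perm_inj /(congr1 val) /= ; lia.
by case: e {steps monoE IHd}; lia.
Qed.

Lemma monotone_segmentP (a c : 'I_n) :
  reflect ((a <= c)%N /\ exists e, forall i, (a <= i < c)%N -> b i = e)
          (monotone_segment pi a c).
Proof.
apply: (iffP andP) => [[le_ac /orP mono]|[le_ac [e /monotone_onP mono]]]; split=> //.
  by case: mono => mono; [exists true | exists false]; apply/monotone_onP.
by apply/orP; case: e mono; [left | right].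
Qed.

Lemma monotone_segment_sub (a c a' c' : 'I_n) :
    (a <= a')%N -> (a' <= c')%N -> (c' <= c)%N ->
  monotone_segment pi a c -> monotone_segment pi a' c'.
Proof.
move=> le_aa le_ac le_cc /monotone_segmentP[_ [e steps]].
apply/monotone_segmentP; split=> //; exists e => i i_in; apply: steps; lia.
Qed.

Lemma birunP (a c : 'I_n) :
  reflect (monotone_segment pi a c /\ forall a' c' : 'I_n, (a' <= a)%N -> (c <= c')%N ->
             monotone_segment pi a' c' -> a' = a /\ c' = c)
          (birun pi a c).
Proof.
apply: (iffP andP) => -[mono maxi]; split=> //.
  move=> a' c' le_a le_c mono'; have /forallP/(_ c') := forallP maxi a'.
  by rewrite le_a le_c mono' => /andP[/eqP -> /eqP ->].
apply/forallP => a'; apply/forallP => c'; apply/implyP => /and3P[le_a le_c mono'].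
by have [-> ->] := maxi _ _ le_a le_c mono'; rewrite !eqxx.
Qed.

Lemma birun_end_inj (a c c' : 'I_n) : birun pi a c -> birun pi a c' -> c = c'.
Proof.
wlog le_cc : c c' / (c <= c')%N.
  move=> IH Bc Bc'; case: (leqP c c') => [/IH | /ltnW/IH/(_ Bc' Bc)] //; exact.
move=> /birunP[_ maxi] /birunP[mono _].
by have [] := maxi a c' (leqnn a) le_cc mono.
Qed.

(** A birun starts at the first position, or where the step to the right differs
    from the step to the left; in either case the longest monotone segment with
    this start is a birun. *)
Lemma birun_startP (a : 'I_n) : (1 < n)%N ->
  reflect (exists c, birun pi a c)
          ((a.+1 < n)%N && ((a == 0 :> nat) || turn b a)).
Proof.
move=> n_gt1; apply: (iffP andP) => [[lt_an start] | [c /birunP[mono maxi]]].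
  have mono_aa : monotone_segment pi a a.
    by apply/monotone_segmentP; split=> //; exists true => i; lia.
  case: (arg_maxnP (fun c : 'I_n => c) mono_aa) => c mono_ac c_max.
  exists c; apply/birunP; split=> // a' c' le_a le_c mono'.
  have [le_ac _] := monotone_segmentP _ _ mono_ac.
  have eq_c : c' = c.
    apply/val_inj/eqP; rewrite eqn_leq le_c andbT; apply: c_max.
    by apply: monotone_segment_sub mono' => //; exact: leq_trans le_c.
  split=> //; apply/val_inj; case: (ltngtP a' a) le_a => // lt_a _.
  have lt_ac : (a < c)%N.
    have mono_a1 : monotone_segment pi a (Ordinal lt_an).
      apply/monotone_segmentP; split=> //=; exists (b a) => i i_in.
      by have -> : i = a by lia.
    by have := c_max _ mono_a1.
  have [_ [e steps]] := monotone_segmentP _ _ mono'.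
  case/orP: start => [/eqP a0 | ]; first by rewrite a0 in lt_a.
  rewrite /turn; have -> : previous_step b a = b a.-1 by case: (val a) lt_a.
  by rewrite !steps ?eqxx // eq_c; lia.
have [le_ac [e steps]] := monotone_segmentP _ _ mono.
have lt_ac : (a < c)%N.
  case: (ltngtP a c) le_ac => // /val_inj eq_ac _; rewrite -{}eq_ac in maxi *.
  have [lt_an|le_na] := ltnP a.+1 n.
    have [//||_ eq_c] := maxi a (Ordinal lt_an) (leqnn _); last first.
    - by move/(congr1 val): eq_c => /=; lia.
    - apply/monotone_segmentP; split=> //=; exists (b a) => i i_in.
      by have -> : i = a by lia.
  have lt_p : (a.-1 < n)%N by have := ltn_ord a; lia.
  have [|//||eq_a _] := maxi (Ordinal lt_p) a; last first.
  - by move/(congr1 val): eq_a => /=; lia.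
  - apply/monotone_segmentP; split=> /=; [lia | exists (b a.-1) => i i_in].
    by have -> : i = a.-1 by lia.
  - by rewrite /=; lia.
split; first by have := ltn_ord c; lia.
case: eqP => //= a_gt0; apply/negP => /eqP eq_b.
have lt_p : (a.-1 < n)%N by have := ltn_ord a; lia.
have [|//||eq_a _] := maxi (Ordinal lt_p) c; last first.
- by move/(congr1 val): eq_a => /=; lia.
- apply/monotone_segmentP; split=> /=; [lia | exists e => i i_in].
  have [le_ai|lt_ia] := leqP a i; first by apply: steps; lia.
  rewrite -(steps a) ?leqnn // eq_b; have -> : i = a.-1 by lia.
  by case: (val a) a_gt0.
- by rewrite /=; lia.
Qed.

End CountRuns.

(** For length at least 2 a birun is determined by its start, so the biruns are
    counted by position 0 and the turns at positive positions; the initial descent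
    letter is present exactly when there is a turn at position 0. *)
Lemma udrE n (pi : {perm 'I_n.+1}) : udr pi = (turn_count (ascent pi) n).+1.
Proof.
case: n pi => [|n] pi.
  rewrite /turn_count big_ord0 /udr; transitivity #|[set: 'I_1 * 'I_1]|; last first.
    by rewrite cardsT card_prod card_ord.
  apply: eq_card => -[a c]; rewrite !inE (ord1 a) (ord1 c) /=; apply/orP; left.
  apply/birunP; split; last by move=> a' c' _ _ _; rewrite (ord1 a') (ord1 c').
  by apply/monotone_segmentP; split=> //; exists true => i; rewrite /=; lia.
set b := ascent pi.
pose B := [set ac : 'I_n.+2 * 'I_n.+2 | birun pi ac.1 ac.2].
pose D := [set ac : 'I_n.+2 * 'I_n.+2 | initial_descent_letter pi ac.1 ac.2].
pose S := [set a : 'I_n.+2 | (a.+1 < n.+2)%N && ((a == 0 :> nat) || turn b a)].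
have BD0 : B :&: D = set0.
  apply/setP => -[a c]; rewrite !inE /=; apply/negbTE/negP => /andP[/birunP[_ maxi]].
  case/and3P => /eqP a0 /eqP c0 _.
  have [||_ /(congr1 val)] := maxi a (@Ordinal n.+2 1 isT) (leqnn a); last by rewrite /= c0.
  - by rewrite c0.
  apply/monotone_segmentP; split; rewrite a0 //; exists (b 0%N) => -[|i] //.
have -> : udr pi = (#|B| + #|D|)%N.
  rewrite -cardsUI BD0 cards0 addn0 /udr; apply: eq_card => ac.
  by rewrite !inE.
have -> : #|B| = #|S|.
  have fst_inj : {in B &, injective (fun ac : 'I_n.+2 * 'I_n.+2 => ac.1)}.
    move=> [a c] [a' c']; rewrite !inE /= => Bac Bac' eq_a; rewrite -eq_a in Bac' *.
    by rewrite (birun_end_inj Bac Bac').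
  rewrite -(card_in_imset fst_inj); apply: eq_card => a; rewrite inE.
  apply/imsetP/(birun_startP pi a (isT : 1 < n.+2)%N) => [[[a' c]]|[c Bac]].
    by rewrite inE /= => Bac ->; exists c.
  by exists (a, c); rewrite ?inE.
have -> : #|D| = turn b 0.
  rewrite /turn eqb_id /=; have b0 : b 0%N = (pi ord0 < pi (@Ordinal n.+2 1 isT))%N.
    exact: (@ascentE _ pi ord0).
  have inD : ((ord0, ord0) \in D) = ~~ b 0%N.
    rewrite inE /= b0 -leqNgt; apply/existsP/idP => [[j /andP[/eqP j1 /ltnW]]|].
      by have -> : j = Ordinal (isT : 1 < n.+2)%N by apply/val_inj.
    move=> le; exists (Ordinal (isT : 1 < n.+2)%N); rewrite /= ltn_neqAle le andbT.
    by apply/eqP => /val_inj/perm_inj.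
  have D0 ac : ac \in D -> ac = (ord0, ord0).
    case: ac => a c; rewrite inE => /and3P[/eqP a0 /eqP c0 _].
    by congr (_, _); apply/val_inj.
  case: (b 0%N) inD => inD /=.
    by apply/eqP; rewrite cards_eq0; apply/eqP/setP => ac; rewrite in_set0;
      apply/negbTE/negP => acD; rewrite -(D0 _ acD) acD in inD.
  rewrite -(cards1 (ord0 : 'I_n.+2, ord0 : 'I_n.+2)); apply: eq_card => ac.
  by rewrite in_set1; apply/idP/eqP => [/D0 | ->].
have -> : #|S| = (\sum_(a < n.+2) ((a.+1 < n.+2) && ((a == 0 :> nat) || turn b a)))%N.
  by rewrite -sum1_card big_mkcond; apply: eq_bigr => a _; rewrite inE; case: (_ && _).
rewrite /turn_count big_ord_recr /= ltnn addn0 big_ord_recl /= [in RHS]big_ord_recl /=.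
rewrite add1n addSn addnC; congr ((_ + _).+1)%N.
apply: eq_bigr => i _; have -> // : ((bump 0 i).+1 < n.+2)%N by have := ltn_ord i; rewrite /bump; lia.
Qed.

(** * Summation over the number of letters *)

Lemma I_udr_fix_rmorph (A B : comNzRingType) (g : {rmorphism A -> B}) n t z :
  g (I_udr_fix n t z) = I_udr_fix n (g t) (g z).
Proof.
rewrite /I_udr_fix rmorph_sum; apply: eq_bigr => pi _.
by rewrite rmorphM !rmorphXn.
Qed.

Section ConstantSeries.
Variables (K : comUnitRingType) (t z : K).
Hypotheses (unit2 : (2%:R : K) \is a GRing.unit) (unit_t : 1 - t \is a GRing.unit).
Hypotheses (unit_Nt2 : 1 - t ^+ 2 \is a GRing.unit).
Hypotheses (unit_Dt2 : 1 + t ^+ 2 \is a GRing.unit).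

Lemma fpsC_inv_1t : 1 / (1 - fpsC t) = fpsC (1 / (1 - t)).
Proof. by rewrite rmorph_div // rmorphB rmorph1. Qed.

Lemma fpsC_prefactor :
  1 / (2%:R * (1 - fpsC t) ^+ 2) = fpsC (1 / (2%:R * (1 - t) ^+ 2)).
Proof.
rewrite rmorph_div ?unitrM ?unit2 ?unitrX ?unit_t //.
by rewrite rmorphM rmorphXn rmorphB rmorph1 rmorph_nat.
Qed.

Lemma fpsC_udr_term n :
  (1 + fpsC t ^+ 2) ^+ n / (1 - fpsC t ^+ 2) ^+ n.-1 *
    I_udr_fix n (2%:R * fpsC t / (1 + fpsC t ^+ 2)) (fpsC z) =
  fpsC ((1 + t ^+ 2) ^+ n / (1 - t ^+ 2) ^+ n.-1 *
    I_udr_fix n (2%:R * t / (1 + t ^+ 2)) z).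
Proof.
have divE (f g : K) : g \is a GRing.unit -> fpsC f / fpsC g = fpsC (f / g).
  by move=> unit_g; rewrite rmorphM rmorphV.
have -> : 1 + fpsC t ^+ 2 = fpsC (1 + t ^+ 2) by rewrite rmorphD rmorph1 rmorphXn.
have -> : 1 - fpsC t ^+ 2 = fpsC (1 - t ^+ 2) by rewrite rmorphB rmorph1 rmorphXn.
have -> : 2%:R * fpsC t = fpsC (2%:R * t) by rewrite rmorphM rmorph_nat.
rewrite (divE _ _ unit_Dt2) -!(rmorphXn (@fpsC K)) -I_udr_fix_rmorph.
by rewrite divE ?unitrX // -rmorphM.
Qed.

Lemma chain_series_term k :
  ((1 + fpsC z * fpsX K) ^+ k * (1 + fpsX K ^+ 2) ^+ (k ^ 2) * fpsC t ^+ (2 * k))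
  / ((1 - fpsC z * fpsX K) ^+ k * (1 - fpsX K ^+ 2) ^+ (k ^ 2))
  * (1 + ((1 + fpsX K ^+ 2) ^+ k * fpsC t)
       / ((1 - fpsC z * fpsX K) * (1 - fpsX K ^+ 2) ^+ k)) =
  fpsC (t ^+ k.*2) * chain_series z k.*2 +
  fpsC (t ^+ k.*2.+1) * chain_series z k.*2.+1.
Proof.
rewrite chain_series_odd chain_series_even.
rewrite [t ^+ k.*2.+1]exprS rmorphM !rmorphXn mul2n.
have expand (P T D c u E : {fps K}) :
  P * T * D * (1 + c * u * E) = T * (P * D) + u * T * (P * D * (c * E)) by ring.
exact: expand.
Qed.

End ConstantSeries.

Section InvolutionSeries.
Variables (R : comUnitRingType) (z : {fps R}).
Notation t := (fpsX R).

Definition label_count n (pi : {perm 'I_n}) (m : nat) : nat :=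
  #|[set f : {ffun 'I_n -> 'I_m} | labeling pi f]|.

Definition label_series n (pi : {perm 'I_n}) : {fps R} :=
  Fps (fun m => (label_count pi m)%:R).

Lemma chain_series_coef_count n m : (chain_series z m).[# n] =
  \sum_(pi in involutions n) z ^+ fix_count pi * (label_count pi m)%:R.
Proof.
rewrite chain_series_coef.
transitivity (\sum_(pi in involutions n)
   \sum_(f : {ffun 'I_n -> 'I_m} | labeling pi f) z ^+ fix_count pi).
  rewrite (exchange_big_dep predT) //= pair_big_dep /=; apply: eq_bigl => x.
  by rewrite inE.
apply: eq_bigr => pi _; rewrite sumr_const mulr_natr; congr (_ *+ _).
by rewrite /label_count cardsE.
Qed.

(** Multiplication by t^m hides all coefficients below degree m, so finitely many
    letters settle each coefficient. *)
Lemma label_series_trunc n (pi : {perm 'I_n}) j M : (j < M)%N ->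
  eq_upto j (\sum_(m < M) t ^+ m * (label_count pi m)%:R) (label_series pi).
Proof.
move=> lt_jM k le_kj; rewrite fps_coef_sum [RHS]/=.
have termE m : (t ^+ m * (label_count pi m)%:R).[# k] =
    (label_count pi m)%:R * (k == m)%:R.
  by rewrite mulrC -(rmorph_nat (@fpsC R)) fps_coefCM fps_coefXn.
have lt_kM := leq_ltn_trans le_kj lt_jM.
under eq_bigr do rewrite termE.
rewrite (bigD1 (Ordinal lt_kM)) //= eqxx mulr1 big1 ?addr0 // => m.
by rewrite -(inj_eq val_inj) /= eq_sym => /negbTE ->; rewrite mulr0.
Qed.

Lemma label_series0 (pi : {perm 'I_0}) : label_series pi = 1 / (1 - t).
Proof.
apply: (mulrI (unit_1t R)); rewrite mul1r divrr ?unit_1t //.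
apply/fpsP => n; rewrite mulrBl mul1r fps_coefB fps_coefXM fps_coef1 /=.
have count1 m : label_count pi m = 1%N.
  rewrite -[RHS](expn0 m) -[in RHS](card_ord 0) -[in RHS](card_ord m) -card_ffun.
  rewrite -cardsT; apply: eq_card => f; rewrite !inE.
  by apply/labelingP => -[].
by case: n => [|n]; rewrite /= !count1 ?subr0 ?subrr.
Qed.

Lemma label_seriesS n (pi : {perm 'I_n.+1}) : 2%:R \is a @GRing.unit R ->
  label_series pi = 1 / (2%:R * (1 - t) ^+ 2) *
    ((1 + t ^+ 2) ^+ n.+1 / (1 - t ^+ 2) ^+ n *
     (2%:R * t / (1 + t ^+ 2)) ^+ udr pi).
Proof.
move=> unit2; rewrite udrE -(label_series_closed _ _ unit2).
apply/fpsP => m; rewrite /= -card_steps_ok; congr (_%:R).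
by apply: eq_card => f; rewrite !inE labeling_steps_ok.
Qed.

Definition involution_series n : {fps R} :=
  \sum_(pi in involutions n) z ^+ fix_count pi * label_series pi.

Lemma involution_series0 : involution_series 0 = 1 / (1 - t).
Proof.
have perm0 (pi : {perm 'I_0}) : pi = 1%g by apply/permP => -[].
rewrite /involution_series (bigD1 1%g) ?inE ?mulg1 //= big1 => [|pi]; last first.
  by rewrite (perm0 pi) eqxx andbF.
rewrite addr0 label_series0 /fix_count.
by rewrite (_ : [set i | _] = set0) ?cards0 ?mul1r //; apply/setP => -[].
Qed.

Lemma involution_seriesS n : 2%:R \is a @GRing.unit R ->
  involution_series n.+1 = 1 / (2%:R * (1 - t) ^+ 2) *
    ((1 + t ^+ 2) ^+ n.+1 / (1 - t ^+ 2) ^+ n *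
     I_udr_fix n.+1 (2%:R * t / (1 + t ^+ 2)) z).
Proof.
move=> unit2; rewrite /involution_series /I_udr_fix !mulr_sumr.
apply: eq_bigr => pi _; rewrite (label_seriesS _ unit2).
have swap (c d u w : {fps R}) : w * (c * (d * u)) = c * (d * (u * w)) by ring.
by rewrite swap.
Qed.

End InvolutionSeries.

Section Convergence.
Variable (R : comUnitRingType) (z : {fps R}).
Notation t := (fpsX R).

Lemma chain_partial_sum_coef n j M : (j < M)%N ->
  (\sum_(m < M) fpsC (t ^+ m) * chain_series z m).[# n].[# j] =
  (involution_series z n).[# j].
Proof.
move=> lt_jM; rewrite fps_coef_sum.
under eq_bigr do rewrite fps_coefCM chain_series_coef_count mulr_sumr.
rewrite exchange_big /= /involution_series !fps_coef_sum; apply: eq_bigr => pi _.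
under eq_bigr do rewrite mulrCA.
rewrite -mulr_sumr; apply: (eq_uptoM (n := j)) => //.
exact: label_series_trunc.
Qed.

End Convergence.

Theorem theorem5p18 :
  let x := varx in let t := vart in let z := varz in
  exists A B : QzTX,
    [/\ series_sum 1 (fun n =>
          (1 + t ^+ 2) ^+ n / (1 - t ^+ 2) ^+ n.-1
          * I_udr_fix n (2%:R * t / (1 + t ^+ 2)) z * x ^+ n) A,
        series_sum 0 (fun k =>
          ((1 + z * x) ^+ k * (1 + x ^+ 2) ^+ (k ^ 2) * t ^+ (2 * k))
          / ((1 - z * x) ^+ k * (1 - x ^+ 2) ^+ (k ^ 2))
          * (1 + ((1 + x ^+ 2) ^+ k * t) / ((1 - z * x) * (1 - x ^+ 2) ^+ k))) B &
        1 / (1 - t) + 1 / (2%:R * (1 - t) ^+ 2) * A = B].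
Proof.
move=> x t z.
pose K := {fps {poly rat}}; pose tK : K := fpsX {poly rat}; pose zK : K := fpsC 'X.
have unit2 : (2%:R : {poly rat}) \is a GRing.unit.
  by rewrite -[2%:R](rmorph_nat (@polyC rat)) poly_unitE coefC size_polyC.
have unit2K : (2%:R : K) \is a GRing.unit.
  by rewrite -[2%:R](rmorph_nat (@fpsC {poly rat})) fps_unitE.
pose a n : K := (1 + tK ^+ 2) ^+ n / (1 - tK ^+ 2) ^+ n.-1 *
  I_udr_fix n (2%:R * tK / (1 + tK ^+ 2)) zK.
exists (Fps (fun n => if n is 0 then 0 else a n)), (Fps (involution_series zK)); split.
- move=> n j; exists n.+1 => M lt_nM.
  have termE k : (1 + t ^+ 2) ^+ k / (1 - t ^+ 2) ^+ k.-1 *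
      I_udr_fix k (2%:R * t / (1 + t ^+ 2)) z * x ^+ k = fpsC (a k) * x ^+ k.
    by rewrite -(fpsC_udr_term _ (unit_1x2 _) (unit_1pt2 _)).
  under eq_bigr do rewrite termE.
  rewrite fps_coef_sum; under eq_bigr do rewrite fps_coefCM fps_coefXn.
  congr (_.[# j]); case: n lt_nM => [|n] lt_nM.
    rewrite big_nat_cond big1 // => k /andP[/andP[k_gt0 _] _].
    by case: k k_gt0 => // k _; rewrite mulr0.
  have memN : n.+1 \in index_iota 1 M by rewrite mem_index_iota.
  rewrite (bigD1_seq n.+1 memN (iota_uniq _ _)) /=.
  by rewrite eqxx mulr1 big1 ?addr0 // => k /negbTE; rewrite eq_sym => ->; rewrite mulr0.
- move=> n j; exists j.+1 => M lt_jM.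
  have lt_j2M : (j < M.*2)%N by lia.
  rewrite -(chain_partial_sum_coef zK n lt_j2M); congr (_.[# n].[# j]).
  rewrite big_mkord; elim: M {lt_jM lt_j2M} => [|M IHM]; first by rewrite !big_ord0.
  rewrite big_ord_recr IHM doubleS !big_ord_recr /= -addrA; congr (_ + _).
  exact: chain_series_term.
apply/fpsP => n; rewrite fps_coefD.
rewrite (fpsC_inv_1t (unit_1t _)) (fpsC_prefactor unit2K (unit_1t _)).
rewrite fps_coefCM fps_coefC; case: n => [|n] /=.
  by rewrite mulr0 addr0 involution_series0.
by rewrite add0r involution_seriesS.
Qed.
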